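(* Let the random variable $X$ have absolutely continuous df $F$ with pdf $f$, let $k$ be a fixed positive integer, and let $T_k(x)=\sum_{l=0}^{k-1}\binom{l+r-1}{l}\frac{(-\ln F(x))^l}{(1-\ln F(x))^{l+r}}$ for $x\in\{y:F(y)>0\}$. Then the following results are true. (a) $T_k$ is a df with pdf $t_k(x)=\frac{1}{B(r,k)}\frac{f(x)}{F(x)}\frac{(-\ln F(x))^{k-1}}{(1-\ln F(x))^{r+k}}$, $x\in\{y\in\mathbb{R}:F(y)>0\}$, right extremity $r(T_k)=r(F)$, and $\lim_{x\to r(F)}\frac{1-T_k(x)}{(1-F(x))^k}=\frac{1}{kB(r,k)}$, so that $T_k$ is tail equivalent to $H_k$, where $H_k(x)=1-(1-F(x))^k$, $x\in\mathbb{R}$. (b) If $F\in\mathcal{D}_l(\Phi_\alpha)$, then $r(T_k)=r(F)=\infty$ and $T_k\in\mathcal{D}_l(\Phi_{k\alpha})$, so that $\lim_{n\to\infty}T_k^n(a_nx+b_n)=\Phi_{k\alpha}(x)$ holds with $a_n=F^-\left(1-(1/n)^{1/k}\right)$, $b_n=0$. (c) If $F\in\mathcal{D}_l(\Psi_\alpha)$, then $r(T_k)=r(F)<\infty$ and $T_k\in\mathcal{D}_l(\Psi_{k\alpha})$, so that $\lim_{n\to\infty}T_k^n(a_nx+b_n)=\Psi_{k\alpha}(x)$ holds with $a_n=r(F)-F^-\left(1-(1/n)^{1/k}\right)$, $b_n=r(F)$. (d) If $F\in\mathcal{D}_l(\Lambda)$, and $v$ is a positive function with $\lim_{t\uparrow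 r(F)}\frac{1-F(t+v(t)x)}{1-F(t)}=e^{-x}$ for $x\ge 0$, so that $\lim_{n\to\infty}F^n(a_nx+b_n)=\Lambda(x)$ holds with $a_n=v(b_n)$ and $b_n=F^-(1-\frac1n)$, then $r(T_k)=r(F)$ and $T_k\in\mathcal{D}_l(\Lambda)$, so that $\lim_{n\to\infty}T_k^n(a_nx+b_n)=\Lambda(x)$ holds with (new) constants $a_n=\frac{v(b_n)}{k}$, $b_n=T_k^-(1-1/n)$.
   Context: df means distribution function on $\mathbb{R}$, pdf means probability density function; dfs are specified only at those $x$ where their values lie in $(0,1)$. $r$ (as a number) is the fixed parameter of the negative binomial law with probabilities $\binom{j+r-1}{j}p^r(1-p)^{j}$, $j=0,1,2,\ldots$. $B(\cdot,\cdot)$ is the Beta function. For a df $F$, the right extremity is $r(F)=\sup\{x\in\mathbb{R}:F(x)<1\}$ (not to be confused with the number $r$), and $F^-(y)=\inf\{x:F(x)\ge y\}$. For a parameter $\alpha>0$: $\Phi_\alpha(x)=\exp(-x^{-\alpha})$ for $x>0$ and $0$ for $x\le 0$; $\Psi_\alpha(x)=\exp(-|x|^\alpha)$ for $x<0$ and $1$ for $x\ge 0$; $\Lambda(x)=\exp(-e^{-x})$, $x\in\mathbb{R}$. $F\in\mathcal{D}_l(G)$ means that there exist $a_n>0$, $b_n\in\mathbb{R}$ with $\lim_{n\to\infty}F^n(a_nx+b_n)=G(x)$ at all continuity points $x$ of $G$. Two dfs $A,B$ are tail equivalent if $r(A)=r(B)$ and $\frac{1-A(x)}{1-B(x)}$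 tends to a limit in $(0,\infty)$ as $x\uparrow r(A)$.
   Formalization: In (b), (c) the limits with the printed a_n fail unless kB(r,k)=1 (e.g. r=2, k=1, F(x)=1-1/x). Proved instead: with the printed a_n the limit is Φ_{kα}(x)^{1/(kB(r,k))} (resp. Ψ_{kα}); the limit Φ_{kα} (resp. Ψ_{kα}) holds with 1/n replaced by kB(r,k)/n in a_n. *)

(* Defs.v *)
From HB Require Import structures.
From mathcomp Require Import all_boot all_order all_algebra.
From mathcomp Require Import all_classical all_reals all_analysis.
Import Order.TTheory GRing.Theory Num.Theory.
Import numFieldNormedType.Exports.

Set Implicit Arguments.
Unset Strict Implicit.
Unset Printing Implicit Defensive.

Local Open Scope classical_set_scope.
Local Open Scope ring_scope.

Definition is_df (R : realType) (F : R -> R) : Prop :=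
  [/\ {homo F : x y / x <= y}, right_continuous F,
      F @ -oo --> (0 : R) & F @ +oo --> (1 : R)].

Definition is_pdf (R : realType) (F f : R -> R) : Prop :=
  [/\ measurable_fun [set: R] f, (forall x, 0 <= f x) &
      forall x, (F x)%:E =
        (\int[lebesgue_measure]_(t in `]-oo, x]) (f t)%:E)%E].

Definition right_extremity (R : realType) (F : R -> R) : \bar R :=
  ereal_sup [set x%:E | x in [set x | F x < 1]].

(* [left_filter e] is the filter of x tending to e from below, along reals;
   the value at -oo is junk (a df never has right extremity -oo). *)
Definition left_filter (R : realType) (e : \bar R) : set_system R :=
  match e with
  | EFin a => a^'-
  | EPInf => pinfty_nbhs R
  | ENInf => [set: set R]
  end.

(* For a df F this is the usual generalized inverse when 0 < y < 1. When
   y <= 0 the set is not bounded below and [inf] is 0 by convention; below, this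
   concerns only finitely many terms of the norming sequences. *)
Definition quantile (R : realType) (F : R -> R) (y : R) : R :=
  inf [set x | y <= F x].

Definition Phi (R : realType) (alpha x : R) : R :=
  if 0 < x then expR (- (x `^ (- alpha))) else 0.

Definition Psi (R : realType) (alpha x : R) : R :=
  if x < 0 then expR (- (`|x| `^ alpha)) else 1.

Definition Lambda (R : realType) (x : R) : R := expR (- expR (- x)).

Definition Dl (R : realType) (F G : R -> R) : Prop :=
  exists a b : nat -> R, (forall n, 0 < a n) /\
    (forall x, {for x, continuous G} ->
       F (a n * x + b n) ^+ n @[n --> \oo] --> G x).

Definition tail_equivalent (R : realType) (A B : R -> R) : Prop :=
  right_extremity A = right_extremity B /\
  exists2 c : R, 0 < c &
    (fun x => (1 - A x) / (1 - B x)) @ left_filter (right_extremity A) --> c.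

Definition gbinomial (R : realType) (a : R) (l : nat) : R :=
  (\prod_(i < l) (a - i%:R)) / (l`!)%:R.

(* The [beta_fun] of the library only takes natural number arguments. *)
Definition Beta (R : realType) (a b : R) : R :=
  (\int[lebesgue_measure]_(t in `[0%R, 1%R])
     (t `^ (a - 1) * (1 - t) `^ (b - 1)))%R.

(* Outside {y : F y > 0} the df T_k and its pdf vanish. The case distinction is
   needed: [ln 0 = 0], so the bare sum would be 1 there. *)
Definition Tk (R : realType) (r : R) (k : nat) (F : R -> R) (x : R) : R :=
  if 0 < F x then
    \sum_(l < k) gbinomial (l%:R + r - 1) l *
      ((- ln (F x)) ^+ l / (1 - ln (F x)) `^ (l%:R + r))
  else 0.

Definition tk (R : realType) (r : R) (k : nat) (F f : R -> R) (x : R) : R :=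
  if 0 < F x then
    1 / Beta r k%:R * (f x / F x) *
      ((- ln (F x)) ^+ k.-1 / (1 - ln (F x)) `^ (r + k%:R))
  else 0.

Definition Hk (R : realType) (k : nat) (F : R -> R) (x : R) : R :=
  1 - (1 - F x) ^+ k.

(* Main.v *)
(* The df T_k is G o F, where G is continuously differentiable on ]0, 1] and
   1 - G p is equivalent to C (1 - p)^k as p tends to 1, with C = 1 / (k B(r, k)).

   Since F is only absolutely continuous, T_k need not be differentiable
   everywhere; its density h(F) f, where h = G', is found by noting that for
   x <= y close to s both the integral of h(F) f over ]x, y] and
   G (F y) - G (F x) differ from h(F s) (F y - F x) by at most
   epsilon (F y - F x), and by chaining these local estimates.

   For the domains of attraction, n (1 - F (a_n x + b_n)) -> rho x with rho
   strictly decreasing, so a sequence c_n with n (1 - F c_n) -> rho x0 satisfies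
   (c_n - b_n) / a_n -> x0 by monotonicity alone. Comparing the indices n and 2n
   gives a_2n / a_n -> 2^(1/alpha) (Frechet) or 2^(-1/alpha) (Weibull) and
   (b_2n - b_n) / a_n -> 0, which locates b_n: (b_n - beta) / a_n -> 0 for all
   beta, respectively for beta = r(F). Hence 1 - F varies regularly at r(F), and
   the tail of T_k inherits the kth power of the limiting ratio. In the Gumbel
   case the given v is compared with a_n in the same way. *)

Require Import Defs.
From HB Require Import structures.
From mathcomp Require Import all_boot all_order all_algebra.
From mathcomp Require Import all_classical all_reals all_analysis.
From mathcomp Require Import measurable_realfun ring lra.
Import Order.TTheory GRing.Theory Num.Theory.
Import numFieldNormedType.Exports.

Set Implicit Arguments.
Unset Strict Implicit.
Unset Printing Implicit Defensive.

Local Open Scope classical_set_scope.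
Local Open Scope ring_scope.

(** * Negative binomial sums and the Beta function *)

(** The constant C decides the shape of the limit laws. With the norming F^-(1 - (1/n)^(1/k)) the
    quantity n (1 - T_k) tends to C times the exponent of Phi or Psi, so the limit is the power C of
    that law, a law of the same type. With k B(r, k) / n in place of 1/n the constant is absorbed
    and the law itself appears. In the Gumbel case the centering is a quantile of T_k, so C cancels
    in a ratio of two tails.

    A domain of attraction provides unknown constants indexed by integers, whereas the claims
    concern quantiles. The bridge is the index n = floor (1 / (1 - F c)) attached to a point c:
    there n (1 - F c) -> 1, which locates c in the coordinate (x - b_n) / a_n. *)

(* In closed form, nbcoef r l is Gamma(r + l) / (Gamma(r) l!). *)
Definition nbcoef (R : realType) (r : R) (l : nat) : R :=
  (\prod_(i < l) (r + i%:R)) / l`!%:R.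

(** Read backwards, the falling factors l + r - 1 - i are the rising factors r + i. *)
Lemma gbinomial_nbcoef (R : realType) (r : R) (l : nat) :
  gbinomial (l%:R + r - 1) l = nbcoef r l.
Proof.
rewrite /gbinomial /nbcoef; congr (_ / _).
rewrite (reindex_inj rev_ord_inj) /=; apply: eq_bigr => i _.
have -> : l%:R = (l - i.+1)%:R + i.+1%:R :> R by rewrite -natrD subnK.
by rewrite -natr1; ring.
Qed.

Lemma nbcoef_gt0 (R : realType) (r : R) (l : nat) : 0 < r -> 0 < nbcoef r l.
Proof.
move=> r0; rewrite divr_gt0 ?ltr0n ?fact_gt0//.
by apply: prodr_gt0 => i _; rewrite ltr_wpDr.
Qed.

Lemma nbcoef0 (R : realType) (r : R) : nbcoef r 0 = 1.
Proof. by rewrite /nbcoef big_ord0 fact0 divr1. Qed.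

Lemma nbcoefS (R : realType) (r : R) (l : nat) :
  l.+1%:R * nbcoef r l.+1 = (r + l%:R) * nbcoef r l.
Proof.
rewrite /nbcoef big_ord_recr/= factS natrM.
have l0 : l.+1%:R != 0 :> R by rewrite pnatr_eq0.
have f0 : l`!%:R != 0 :> R by rewrite pnatr_eq0 -lt0n fact_gt0.
by field; rewrite f0 addrC natr1.
Qed.

(** Both sides are r (r + 1) ... (r + l) / l!. *)
Lemma nbcoef_shift (R : realType) (r : R) (l : nat) :
  r * nbcoef (r + 1) l = (r + l%:R) * nbcoef r l.
Proof.
rewrite /nbcoef !mulrA; congr (_ / _).
elim: l => [|l IH]; first by rewrite !big_ord0; ring.
rewrite !big_ord_recr/= mulrA IH -natr1; ring.
Qed.

(* The probability that a negative binomial variable with success probability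
   1 / (1 + u) is less than k. *)
Definition nbS (R : realType) (r : R) (k : nat) (u : R) : R :=
  \sum_(l < k) gbinomial (l%:R + r - 1) l * (u ^+ l / (1 + u) `^ (l%:R + r)).

Lemma is_derive_exprn (R : realType) (k : nat) (u : R) :
  is_derive u 1 (fun x : R => x ^+ k) (k%:R * u ^+ k.-1).
Proof.
have := @is_deriveX _ _ id k u 1 1 (is_derive_id _ _).
by rewrite /GRing.scale/= mulr1 exprfctE.
Qed.

(** The sum telescopes: with D_l = l c_l u^(l-1) / (1 + u)^(r+l) and c_l = [nbcoef r l], the
    recurrence [nbcoefS] makes the derivative of the lth term D_l - D_(l+1), and D_0 = 0. *)
Lemma is_derive_nbS (R : realType) (r : R) (k : nat) (u : R) : -1 < u ->
  is_derive u 1 (nbS r k)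
    (- (k%:R * nbcoef r k) * (u ^+ k.-1 / (1 + u) `^ (r + k%:R))).
Proof.
move=> u1; have u0 : 0 < 1 + u by lra.
have p0 x : (1 + u) `^ x != 0 by rewrite gt_eqF// powR_gt0.
elim: k => [|k IH].
  rewrite !mul0r oppr0 mul0r (_ : nbS r 0 = cst 0); first exact: is_derive_cst.
  by apply/funext => x; rewrite /nbS big_ord0.
rewrite (_ : nbS r k.+1 = nbS r k \+
    (fun u => nbcoef r k * (u ^+ k * (1 + u) `^ (- (k%:R + r))))); last first.
  by apply/funext => x; rewrite /nbS big_ord_recr/= gbinomial_nbcoef powRN.
have d1 : is_derive u 1 (fun u : R => 1 + u) 1.
  by rewrite -[X in is_derive _ _ _ X]add0r; apply: is_deriveD.
have d2 : is_derive u 1 ((fun x : R => x `^ (- (k%:R + r))) \o (fun u : R => 1 + u))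
   (- (k%:R + r) * (1 + u) `^ (- (k%:R + r) - 1) * 1).
  by apply: is_derive1_comp; exact: is_derive1_powR.
have d4 := is_deriveM (is_derive_exprn k u) d2.
have d5 := is_deriveD IH (is_deriveZ (nbcoef r k) d4).
apply: is_derive_eq d5 _.
rewrite /GRing.scale/= nbcoefS.
have -> : - (k%:R + r) - 1 = - (r + k.+1%:R) by rewrite -natr1; ring.
rewrite [k%:R + r]addrC !powRN.
have -> : (1 + u) `^ (r + k.+1%:R) = (1 + u) `^ (r + k%:R) * (1 + u).
  rewrite -natr1 addrA [LHS]powRD; last by rewrite (gt_eqF u0) implybT.
  by rewrite powRr1 ?ltW.
by field; rewrite p0 gt_eqF.
Qed.

Lemma nbS0 (R : realType) (r : R) (k : nat) : (0 < k)%N -> nbS r k 0 = 1.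
Proof.
case: k => // k _; rewrite /nbS big_ord_recl/= big1 ?addr0 => [|i _].
  by rewrite gbinomial_nbcoef nbcoef0 expr0 powR1 divr1 mulr1.
by rewrite /bump/= expr0n/= mul0r mulr0.
Qed.

(** The functions c s^k and 1 - [nbS] both vanish at s = 0, so an inequality between their
    derivatives on ]0, u[ passes to the functions. *)
Lemma ler_derive_nbS (R : realType) (r : R) (k : nat) (c u : R) : (0 < k)%N -> 0 <= u ->
  (forall s : R, 0 < s < u -> c * (k%:R * s ^+ k.-1) <=
     k%:R * nbcoef r k * (s ^+ k.-1 / (1 + s) `^ (r + k%:R))) ->
  c * u ^+ k <= 1 - nbS r k u.
Proof.
move=> k0 u0 H.
have D (s : R) : -1 < s -> is_derive s 1 (- nbS r k - c *: (fun s : R => s ^+ k))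
  (k%:R * nbcoef r k * (s ^+ k.-1 / (1 + s) `^ (r + k%:R)) - c * (k%:R * s ^+ k.-1)).
  move=> s1.
  have d4 := is_deriveB (is_deriveN (is_derive_nbS r k s1)) (is_deriveZ c (is_derive_exprn k s)).
  by apply: is_derive_eq d4 _; rewrite /GRing.scale/= mulNr opprK.
have := @ger0_derive1_le_cc _ (- nbS r k - c *: (fun s : R => s ^+ k)) 0 u.
move=> /(_ _ _ _ 0 u); rewrite !in_itv/= !lexx u0 => /(_ _ _ _ isT isT isT).
rewrite !fctE/= nbS0// expr0n gtn_eqF// /GRing.scale/= mulr0 subr0 => E.
have : -1 <= - nbS r k u - c * u ^+ k.
  apply: E.
  - by move=> x; rewrite in_itv/= => /andP[x0 _]; have [] // := D x _; lra.
  - move=> x; rewrite in_itv/= => xu; have x1 : -1 < x by lra.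
    by rewrite derive1E (@derive_val _ _ _ _ _ _ _ (D x x1)) subr_ge0 H.
  - apply: continuous_in_subspaceT => x /[!inE]/= /[!in_itv]/= /andP[x0 _].
    apply: differentiable_continuous; apply/derivable1_diffP.
    by have [] // := D x _; lra.
lra.
Qed.

(** The derivative of 1 - [nbS] is that of c_k s^k divided by (1 + s)^(r+k) >= 1. *)
Lemma nbS_upper (R : realType) (r : R) (k : nat) (u : R) : 0 < r -> (0 < k)%N -> 0 <= u ->
  1 - nbS r k u <= nbcoef r k * u ^+ k.
Proof.
move=> r0 k0 u0.
have D (s : R) : -1 < s -> is_derive s 1 (nbS r k + nbcoef r k *: (fun s : R => s ^+ k))
  (- (k%:R * nbcoef r k) * (s ^+ k.-1 / (1 + s) `^ (r + k%:R)) + nbcoef r k * (k%:R * s ^+ k.-1)).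
  move=> s1.
  exact: is_deriveD (is_derive_nbS r k s1) (is_deriveZ (nbcoef r k) (is_derive_exprn k s)).
have := @ger0_derive1_le_cc _ (nbS r k + nbcoef r k *: (fun s : R => s ^+ k)) 0 u.
move=> /(_ _ _ _ 0 u); rewrite !in_itv/= !lexx u0 => /(_ _ _ _ isT isT isT).
rewrite !fctE/= nbS0// expr0n gtn_eqF// /GRing.scale/= mulr0 addr0 => E.
have : 1 <= nbS r k u + nbcoef r k * u ^+ k.
  apply: E.
  - by move=> x; rewrite in_itv/= => /andP[x0 _]; have [] // := D x _; lra.
  - move=> x; rewrite in_itv/= => /andP[x0 _]; have x1 : -1 < x by lra.
    rewrite derive1E (@derive_val _ _ _ _ _ _ _ (D x x1)).
    rewrite mulNr addrC subr_ge0 mulrA [X in _ <= X * _]mulrC ler_wpM2l//.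
      by rewrite mulr_ge0// ltW// nbcoef_gt0.
    rewrite ler_piMr ?exprn_ge0 ?(ltW x0)// invf_le1 ?powR_gt0//; last lra.
    rewrite -[leLHS](powRr0 (1 + x)) ler_powR//; first by lra.
    by rewrite addr_ge0 ?(ltW r0).
  - apply: continuous_in_subspaceT => x /[!inE]/= /[!in_itv]/= /andP[x0 _].
    apply: differentiable_continuous; apply/derivable1_diffP.
    by have [] // := D x _; lra.
lra.
Qed.

(** On ]0, u[ the divisor (1 + s)^(r+k) in the derivative is at most (1 + u)^(r+k). *)
Lemma nbS_lower (R : realType) (r : R) (k : nat) (u : R) : 0 < r -> (0 < k)%N -> 0 <= u ->
  nbcoef r k * u ^+ k / (1 + u) `^ (r + k%:R) <= 1 - nbS r k u.
Proof.
move=> r0 k0 u0; rewrite mulrAC.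
apply: ler_derive_nbS => // s /andP[s0 su].
have p0 (x : R) : 0 < x -> 0 < (1 + x) `^ (r + k%:R) by move=> x0; rewrite powR_gt0//; lra.
rewrite [leLHS](_ : _ = k%:R * nbcoef r k * (s ^+ k.-1 / (1 + u) `^ (r + k%:R))); last by ring.
apply: ler_wpM2l; first by rewrite mulr_ge0// ltW// nbcoef_gt0.
apply: ler_wpM2l; first by rewrite exprn_ge0// ltW.
rewrite lef_pV2 ?posrE ?p0//; last exact: lt_trans su.
rewrite ge0_ler_powR ?nnegrE//; [|lra..].
by rewrite addr_ge0 ?(ltW r0).
Qed.

Lemma continuous_powRl (R : realType) (p x : R) : 0 < x ->
  {for x, continuous (fun y : R => y `^ p)}.
Proof.
move=> x0; apply: differentiable_continuous; apply/derivable1_diffP.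
by have [] := is_derive1_powR p x0.
Qed.

Lemma integral_powR01 (R : realType) (a : R) : 0 < a ->
  (\int[lebesgue_measure]_(t in `[0%R, 1%R]) (t `^ (a - 1))%:E = (a^-1)%:E)%E.
Proof.
move=> a0.
rewrite -integral_itv_obnd_cbnd; last first.
  by apply/measurable_EFinP; apply: measurable_funTS; exact: measurable_powR.
(* These intervals avoid the possible singularity of t^(a-1) at 0. Starting from 1/2 keeps them
   nondegenerate, as the fundamental theorem of calculus requires. *)
pose I n := `[(n.+2%:R : R)^-1, 1%R]%classic.
have -> : `]0%R, 1%R]%classic = \bigcup_n I n.
  apply/seteqP; split => x /=; rewrite in_itv/=.
    move=> /andP[x0 x1]; exists (Num.bound x^-1) => //.
    rewrite /I/= in_itv/= x1 andbT invf_ple ?posrE ?ltr0n//.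
    have := archi_boundP (ltW (_ : 0 < x^-1)); rewrite invr_gt0 => /(_ x0) /ltW/le_trans; apply.
    by rewrite ler_nat -addn2 leq_addr.
  move=> [n _]; rewrite /I/= in_itv/= => /andP[nx ->]; rewrite andbT.
  by apply: lt_le_trans nx; rewrite invr_gt0.
have cI : (\int[lebesgue_measure]_(t in I n) (t `^ (a - 1))%:E)%E @[n --> \oo] -->
    (\int[lebesgue_measure]_(t in \bigcup_n I n) (t `^ (a - 1))%:E)%E.
  apply: ge0_nondecreasing_set_cvg_integral.
  - apply/nondecreasing_seqP => n; rewrite subsetEset => x; rewrite /I/= !in_itv/=.
    move=> /andP[nx ->]; rewrite andbT (le_trans _ nx)// lef_pV2 ?posrE ?ltr0n//.
    by rewrite ler_nat.
  - by move=> n; exact: measurable_itv.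
  - by move=> n; apply/measurable_EFinP; apply: measurable_funTS; exact: measurable_powR.
  - by move=> n x _; rewrite lee_fin powR_ge0.
apply: (cvg_unique _ cI) => //.
have E n : (\int[lebesgue_measure]_(t in I n) (t `^ (a - 1))%:E)%E =
    (a^-1 - a^-1 * (n.+2%:R^-1) `^ a)%:E.
  have n0 : 0 < n.+2%:R^-1 :> R by rewrite invr_gt0.
  have D (x : R) : 0 < x -> is_derive x 1 (a^-1 *: (fun t : R => t `^ a)) (x `^ (a - 1)).
    move=> x0; apply: is_derive_eq (is_deriveZ _ (is_derive1_powR a x0)) _.
    by rewrite /GRing.scale/= mulrA mulVf ?mul1r// gt_eqF.
  rewrite (@continuous_FTC2 _ _ (a^-1 *: (fun t : R => t `^ a))).
  - by rewrite -EFinB !fctE/= powR1/GRing.scale/= mulr1.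
  - by rewrite invf_lt1 ?ltr0n// ltr1n.
  - apply: continuous_in_subspaceT => x /[!inE]/= /[!in_itv]/= /andP[x0 _].
    by apply: continuous_powRl; exact: lt_le_trans x0.
  - split.
    + by move=> x; rewrite in_itv/= => /andP[x0 _]; have [] := D _ (lt_trans n0 x0).
    + apply: cvg_at_right_filter; apply: differentiable_continuous; apply/derivable1_diffP.
      by have [] := D _ n0.
    + apply: cvg_at_left_filter; apply: differentiable_continuous; apply/derivable1_diffP.
      by have [] := D _ ltr01.
  - move=> x; rewrite in_itv/= => /andP[x0 _].
    by rewrite derive1E; have [_ ->] := D _ (lt_trans n0 x0).
rewrite /= (eq_cvg _ _ E).
apply: cvg_EFin; first exact: nearW.
rewrite -[X in _ --> X]subr0 -[X in _ - X](mulr0 a^-1).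
apply: cvgB; first exact: cvg_cst.
apply: cvgM; first exact: cvg_cst.
move/cvg_at_rightP : (powR_cvg0 a0); apply; split => [n|]; first by rewrite invr_gt0.
by have := @cvg_harmonic R; rewrite -(@cvg_shiftS R^o (@harmonic R)).
Qed.

(** As k - 1 is a natural number, (1 - t)^(k-1) <= 1 and t^(r-1) dominates. *)
Lemma integrable_beta (R : realType) (r : R) (k : nat) : 0 < r -> (0 < k)%N ->
  lebesgue_measure.-integrable `[0%R, 1%R]
    (EFin \o (fun t : R => t `^ (r - 1) * (1 - t) `^ (k%:R - 1))).
Proof.
move=> r0 k0.
have i1 : lebesgue_measure.-integrable `[0%R, 1%R] (EFin \o (fun t : R => t `^ (r - 1))).
  apply/integrableP; split.
    by apply/measurable_EFinP; apply: measurable_funTS; exact: measurable_powR.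
  under eq_integral do rewrite /= ger0_norm ?powR_ge0//.
  by rewrite integral_powR01// ltry.
apply: (le_integrable _ _ _ i1) => //.
  apply/measurable_EFinP; apply: measurable_funTS; apply: measurable_funM.
    exact: measurable_powR.
  apply: (@measurableT_comp _ _ _ _ _ _ (fun t => t `^ (k%:R - 1))); first exact: measurable_powR.
  exact: measurable_funB.
move=> t /=; rewrite in_itv/= => /andP[t0 t1]; rewrite lee_fin !ger0_norm ?mulr_ge0 ?powR_ge0//.
rewrite ler_piMr ?powR_ge0//.
have -> : k%:R - 1 = k.-1%:R :> R by rewrite -subn1 natrB.
by rewrite powR_mulrn ?subr_ge0// exprn_ile1 ?subr_ge0// gerBl.
Qed.

(** Splitting one factor 1 - t gives B(r, k + 1) = B(r, k) - B(r + 1, k). The induction on k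
    therefore needs all r at once, and [nbcoef_shift] with [nbcoefS] shows that the right-hand side
    obeys the same recurrence. *)
Lemma Beta_nbcoef (R : realType) (r : R) (k : nat) : 0 < r -> (0 < k)%N ->
  k%:R * Beta r k%:R = (nbcoef r k)^-1.
Proof.
move=> + k0; elim: k r k0 => // k IH r _ r0.
case: k IH => [_|k IH].
  have -> : nbcoef r 1 = r by have := nbcoefS r 0; rewrite nbcoef0 !mulr1 addr0 mul1r.
  rewrite mul1r /Beta /Rintegral.
  under eq_integral do rewrite subrr powRr0 mulr1.
  by rewrite integral_powR01.
have r1 : 0 < r + 1 by rewrite addr_gt0.
have E : Beta r k.+2%:R = Beta r k.+1%:R - Beta (r + 1) k.+1%:R.
  rewrite /Beta -RintegralB//; [|exact: integrable_beta..].
  apply: eq_Rintegral => t; rewrite inE/= in_itv/= => /andP[t0 t1].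
  have -> : r + 1 - 1 = r by ring.
  have k0 : 0 < k.+1%:R :> R by rewrite ltr0n.
  have -> : k.+2%:R - 1 = k.+1%:R :> R by rewrite -natr1; ring.
  rewrite -(mulr_powRB1 t0 r0) -[in LHS](@mulr_powRB1 _ (1 - t) k.+1%:R) ?subr_ge0//.
  ring.
have h1 := IH r isT r0; have h2 := IH (r + 1) isT r1.
have c0 := nbcoef_gt0 k.+1 r0; have c1 := nbcoef_gt0 k.+1 r1.
have e1 := nbcoef_shift r k.+1; have e2 := nbcoefS r k.+1.
have c2 := nbcoef_gt0 k.+2 r0.
have kp : 0 < k.+1%:R :> R by rewrite ltr0n.
have kp2 : 0 < k.+2%:R :> R by rewrite ltr0n.
have -> : nbcoef r k.+2 = (r + k.+1%:R) * nbcoef r k.+1 / k.+2%:R.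
  by rewrite -e2 mulrC mulKf// gt_eqF.
have B1 : Beta r k.+1%:R = (nbcoef r k.+1)^-1 / k.+1%:R.
  by rewrite -h1 mulrC mulKf// gt_eqF.
have B2 : Beta (r + 1) k.+1%:R = r / ((r + k.+1%:R) * nbcoef r k.+1) / k.+1%:R.
  have -> : Beta (r + 1) k.+1%:R = (nbcoef (r + 1) k.+1)^-1 / k.+1%:R.
    by rewrite -h2 mulrC mulKf// gt_eqF.
  rewrite -e1; field; rewrite !gt_eqF//.
rewrite E B1 B2; field; rewrite !gt_eqF//.
by rewrite addr_gt0.
Qed.

Lemma Beta_gt0 (R : realType) (r : R) (k : nat) : 0 < r -> (0 < k)%N -> 0 < Beta r k%:R.
Proof.
move=> r0 k0; have := Beta_nbcoef r0 k0.
have : 0 < (nbcoef r k)^-1 by rewrite invr_gt0 nbcoef_gt0.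
by move=> + e; rewrite -e pmulr_rgt0// ltr0n.
Qed.

(* The df Tk r k F is nbG r k \o F, and nbh r k is the derivative of nbG r k on
   ]0, 1]. *)
Definition nbG (R : realType) (r : R) (k : nat) (p : R) : R :=
  if 0 < p then nbS r k (- ln p) else 0.

Definition nbh (R : realType) (r : R) (k : nat) (p : R) : R :=
  k%:R * nbcoef r k / p * ((- ln p) ^+ k.-1 / (1 - ln p) `^ (r + k%:R)).

(** Both bounds are ln (1 + x) <= x, at x = y - 1 and at x = 1 / y - 1. *)
Lemma oppln_bounds (R : realType) (y : R) : 0 < y -> 1 - y <= - ln y <= (1 - y) / y.
Proof.
move=> y0; apply/andP; split.
  have := @le_ln1Dx _ (y - 1) _; rewrite subrKC => h.
  have : ln y <= y - 1 by apply: h; lra.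
  lra.
have := @le_ln1Dx _ (y^-1 - 1) _; rewrite subrKC lnV ?posrE// => h.
have -> : (1 - y) / y = y^-1 - 1 by field; rewrite gt_eqF.
by apply: h; rewrite ltrBrDr addNr invr_gt0.
Qed.

Section negative_binomial_transform.
Variables (R : realType) (r : R) (k : nat).
Hypotheses (r0 : 0 < r) (k0 : (0 < k)%N).
Let G := nbG r k.

Let oppln_ge0 (p : R) : p <= 1 -> 0 <= - ln p.
Proof. by move=> p1; rewrite oppr_ge0 ln_le0. Qed.

Lemma nbG1 : G 1 = 1.
Proof. by rewrite /G /nbG ltr01 ln1 oppr0 nbS0. Qed.

(** The lower bound [nbS_lower] is positive as soon as - ln p is. This is what gives T_k and F the
    same right extremity. *)
Lemma nbG_lt1 (p : R) : p <= 1 -> (G p < 1) = (p < 1).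
Proof.
move=> p1; have [pl1|] := ltP p 1; last first.
  by move=> p1'; have -> : p = 1 by [apply/eqP; rewrite eq_le p1 p1']; rewrite nbG1 ltxx.
rewrite /G /nbG; case: ifP => p0; last by rewrite ltr01.
have := nbS_lower r0 k0 (oppln_ge0 p1); set x := (_ / _) => h.
suff : 0 < x by move=> x0; apply/idP; lra.
have u0 : 0 < - ln p by rewrite oppr_gt0 ln_lt0 ?p0.
by rewrite /x divr_gt0 ?powR_gt0 ?addr_gt0// mulr_gt0 ?nbcoef_gt0// exprn_gt0.
Qed.

Lemma nbG_ge0 (p : R) : p <= 1 -> 0 <= G p.
Proof.
move=> p1; rewrite /G /nbG; case: ifP => // p0.
apply: sumr_ge0 => i _; rewrite gbinomial_nbcoef mulr_ge0 ?(ltW (nbcoef_gt0 _ r0))//.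
by rewrite divr_ge0 ?powR_ge0// exprn_ge0// oppln_ge0.
Qed.

(** With u = - ln p, each factor u^l / (1 + u)^l is at most 1. The bound tends to 0 with p, which
    yields continuity of G at 0. *)
Lemma nbG_bound (p : R) : 0 < p <= 1 ->
  G p <= (\sum_(l < k) nbcoef r l) * (1 - ln p) `^ (- r).
Proof.
move=> /andP[p0 p1]; rewrite /G /nbG p0 mulr_suml; apply: ler_sum => i _.
rewrite gbinomial_nbcoef; apply: ler_wpM2l; first by rewrite ltW ?nbcoef_gt0.
have u0 := oppln_ge0 p1; have u1 : 0 < 1 - ln p by lra.
rewrite powRD; last by rewrite (gt_eqF u1) implybT.
rewrite invfM mulrA powRN; apply: ler_piMl; first by rewrite invr_ge0 powR_ge0.
rewrite powR_mulrn ?(ltW u1)// ler_pdivrMr ?exprn_gt0// mul1r.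
by apply: lerXn2r; rewrite ?nnegrE ?(ltW u1)//; lra.
Qed.

(** The point p = 1 is included, with a two-sided derivative, because [nbS] is differentiable for
    all u > -1. *)
Lemma is_derive_nbG (p : R) : 0 < p <= 1 -> is_derive p 1 G (nbh r k p).
Proof.
move=> /andP[p0 p1]; have u0 := oppln_ge0 p1.
have um1 : -1 < - ln p by lra.
have d : is_derive p 1 (nbS r k \o (- @ln R))
    (- (k%:R * nbcoef r k) * ((- ln p) ^+ k.-1 / (1 - ln p) `^ (r + k%:R)) * - p^-1).
  apply: is_derive1_comp; [exact: is_derive_nbS|exact: is_deriveN (is_derive1_ln p0)].
apply: (@near_eq_is_derive _ _ _ (nbS r k \o (- @ln R))).
- near=> q; rewrite /G /nbG ifT//; near: q; exact: lt_nbhsr.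
- by apply: is_derive_eq d _; rewrite /nbh; ring.
Unshelve. all: by end_near. Qed.

Lemma nbh_ge0 (p : R) : 0 < p <= 1 -> 0 <= nbh r k p.
Proof.
move=> /andP[p0 p1]; rewrite /nbh mulr_ge0//.
  by rewrite divr_ge0 ?(ltW p0)// mulr_ge0// ltW// nbcoef_gt0.
by rewrite divr_ge0 ?powR_ge0// exprn_ge0// oppln_ge0.
Qed.

Lemma continuous_nbG (p : R) : p <= 1 -> {for p, continuous G}.
Proof.
move=> p1; have [p0|p0|<-] := ltgtP 0 p.
- apply: differentiable_continuous; apply/derivable1_diffP.
  by have [] := @is_derive_nbG p _; rewrite ?p0.
- have E : \forall q \near p, 0 = G q.
    near=> q; rewrite /G /nbG ifF//; apply/negbTE; rewrite -leNgt ltW//.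
    by near: q; exact: lt_nbhsl.
  have G0 : G p = 0 by rewrite /G /nbG ltNge (ltW p0).
  rewrite /prop_for /continuous_at G0.
  by apply: cvg_trans (near_eq_cvg E) _; exact: cvg_cst.
- have G0 : G 0 = 0 by rewrite /G /nbG ltxx.
  rewrite /prop_for /continuous_at G0; apply/cvgr0Pnorm_le => e e0.
  (* For q > 0 the bound C (1 - ln q)^(-r) is at most e once ln q <= 1 - (C / e)^(1/r). *)
  set C := \sum_(l < k) nbcoef r l.
  have C0 : 0 <= C by apply: sumr_ge0 => i _; rewrite ltW ?nbcoef_gt0.
  near=> q; rewrite ger0_norm ?nbG_ge0//; last by apply: ltW; near: q; exact: lt_nbhsl.
  have q1 : q <= 1 by apply: ltW; near: q; exact: lt_nbhsl.
  have [q0|q0] := ltP 0 q; last by rewrite /G /nbG ltNge q0 /= ltW.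
  apply: le_trans (nbG_bound _) _; first by rewrite q0.
  rewrite -/C powRN.
  have u1 : 0 < 1 - ln q by have := oppln_ge0 q1; lra.
  rewrite ler_pdivrMr ?powR_gt0// mulrC -ler_pdivrMr//.
  have Ce0 : 0 <= C / e by rewrite divr_ge0// ltW.
  have -> : C / e = ((C / e) `^ r^-1) `^ r by rewrite -powRrM mulVf ?gt_eqF// powRr1.
  apply: ge0_ler_powR; rewrite ?nnegrE ?powR_ge0 ?(ltW u1) ?(ltW r0)//.
  suff : ln q <= 1 - (C / e) `^ r^-1 by lra.
  rewrite -[leRHS]expRK ler_ln ?posrE ?expR_gt0//; apply: ltW; near: q.
  by apply: lt_nbhsl; exact: expR_gt0.
Unshelve. all: by end_near. Qed.

Lemma nbG_homo : {in [pred p : R | p <= 1] &, {homo G : p q / p <= q}}.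
Proof.
move=> p q; rewrite !inE => p1 q1 pq.
have [p0|p0] := ltP 0 p; last by rewrite {1}/G /nbG ltNge p0/= nbG_ge0.
have I z : z \in `]p, q[ -> is_derive z 1 G (nbh r k z).
  rewrite in_itv/= => /andP[pz zq]; apply: is_derive_nbG.
  by rewrite (lt_trans p0 pz)/= (le_trans (ltW zq)).
have [|z + E] := MVT_segment pq I.
  apply: continuous_in_subspaceT => z /[!inE]/= /[!in_itv]/= /andP[_ zq].
  by apply: continuous_nbG; exact: le_trans q1.
rewrite in_itv/= => /andP[pz zq].
rewrite -subr_ge0 E mulr_ge0 ?subr_ge0// nbh_ge0// (lt_le_trans p0)//=.
exact: le_trans q1.
Qed.

(* As u := - ln p satisfies 1 - p <= u <= (1 - p) / p, the estimates of 1 - nbS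
   squeeze the ratio (1 - G p) / (1 - p)^k as p tends to 1. *)
Lemma nbG_tail : exists2 K : R -> R, K p @[p --> (1 : R)] --> nbcoef r k &
  forall p, p <= 1 -> 1 - G p = K p * (1 - p) ^+ k.
Proof.
have c0 := nbcoef_gt0 k r0.
exists (fun p => if p < 1 then (1 - G p) / (1 - p) ^+ k else nbcoef r k); last first.
  move=> p p1; have [pl|pl] := ltP p 1.
    by rewrite divfK// expf_neq0// gt_eqF// subr_gt0.
  have -> : p = 1 by apply/eqP; rewrite eq_le p1 pl.
  by rewrite nbG1 !subrr expr0n gtn_eqF// mulr0.
have cl : (1 - ln p) `^ (r + k%:R) @[p --> (1 : R)] --> (1 : R).
  have : {for (1:R), continuous ((fun x : R => x `^ (r + k%:R)) \o (fun p => 1 - ln p))}.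
    apply: continuous_comp.
      by apply: cvgB; [exact: cvg_cst|exact: continuous_ln].
    by apply: continuous_powRl; rewrite ln1 subr0.
  by rewrite /prop_for /continuous_at/= ln1 subr0 powR1.
have c1 : nbcoef r k / (1 - ln p) `^ (r + k%:R) @[p --> (1 : R)] --> nbcoef r k.
  rewrite -[X in _ --> X]divr1; apply: cvgM; first exact: cvg_cst.
  by apply: cvgV; rewrite ?oner_eq0.
have c2 : nbcoef r k / p ^+ k @[p --> (1 : R)] --> nbcoef r k.
  rewrite -[X in _ --> X]divr1; apply: cvgM; first exact: cvg_cst.
  apply: cvgV; rewrite ?oner_eq0//.
  by have := @exprn_continuous R k (1 : R); rewrite /continuous_at/= expr1n.
apply/cvgrPdist_lt => e e0; near=> p.
have p0 : 0 < p by near: p; exact: lt_nbhsr.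
case: ifPn => [p1|]; last by rewrite subrr normr0.
have l1 : `|nbcoef r k - nbcoef r k / (1 - ln p) `^ (r + k%:R)| < e.
  by near: p; move/cvgrPdist_lt : c1; exact.
have l2 : `|nbcoef r k - nbcoef r k / p ^+ k| < e.
  by near: p; move/cvgrPdist_lt : c2; exact.
have u0 := oppln_ge0 (ltW p1).
have lo := nbS_lower r0 k0 u0; have up := nbS_upper r0 k0 u0.
have /andP[e1 e2] := oppln_bounds p0.
have k1 : 0 < (1 - p) ^+ k by rewrite exprn_gt0// subr_gt0.
have E1 : nbcoef r k / (1 - ln p) `^ (r + k%:R) <= (1 - G p) / (1 - p) ^+ k.
  rewrite /G /nbG p0 ler_pdivlMr// (le_trans _ lo)// mulrAC.
  apply: ler_wpM2r; first by rewrite invr_ge0 powR_ge0.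
  apply: ler_wpM2l; first exact: ltW.
  by rewrite lerXn2r ?nnegrE//; lra.
have E2 : (1 - G p) / (1 - p) ^+ k <= nbcoef r k / p ^+ k.
  rewrite /G /nbG p0 ler_pdivrMr// (le_trans up)// [leRHS]mulrAC -[leRHS]mulrA.
  apply: ler_wpM2l; first exact: ltW.
  by rewrite -expr_div_n lerXn2r ?nnegrE// divr_ge0 ?(ltW p0)// subr_ge0 ltW.
by move: l1 l2; rewrite !ltr_distl => /andP[? ?] /andP[? ?]; apply/andP; split; lra.
Unshelve. all: by end_near. Qed.

End negative_binomial_transform.

(** * Densities of transformed distribution functions *)

(** Let s be the supremum of the x in [a, b] with [P a x]. The local hypothesis at s joins a point y
    near s with [P a y] to z = min (b, s + e/2); then z <= s by maximality, which is possible only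
    if z = b. *)
Lemma interval_chain_ind (R : realType) (P : R -> R -> Prop) (a b : R) : a <= b ->
  (forall x y z, a <= x <= y -> y <= z <= b -> P x y -> P y z -> P x z) ->
  (forall s, a <= s <= b -> exists2 e, 0 < e & forall x y, a <= x -> y <= b ->
     s - e < x -> x <= y -> y < s + e -> P x y) ->
  P a b.
Proof.
move=> ab tr loc.
pose S := [set x | a <= x <= b /\ P a x].
have Sa : S a.
  split; first by rewrite lexx.
  by have [|e e0] := loc a; [rewrite lexx|apply => //; lra].
have Sb : has_sup S by split; [exists a|exists b => x [/andP[]]].
set s := sup S.
have as_ : a <= s by apply: ub_le_sup => //; case: Sb.
have sb : s <= b by apply: ge_sup; [exists a|move=> x [/andP[]]].
have [|e e0 H] := loc s; first by rewrite as_.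
have [y [/andP[ay yb] Py] ys] := sup_adherent e0 Sb.
have yles : y <= s by apply: ub_le_sup; [case: Sb|split => //; rewrite ay].
pose z := Num.min b (s + e / 2).
have zb : z <= b by rewrite /z ge_min lexx.
have sz : s <= z by rewrite /z le_min sb/=; lra.
have zse : z < s + e by rewrite /z gt_min; apply/orP; right; lra.
have Pz : P a z.
  by apply: (tr a y z) => //; [rewrite lexx|rewrite (le_trans yles)|
    apply: H => //; exact: le_trans sz].
have zs : z <= s by apply: ub_le_sup; [case: Sb|split => //; rewrite zb andbT (le_trans as_)].
suff -> : b = z by [].
apply/eqP; rewrite eq_le zb andbT leNgt; apply/negP => zltb.
have : s + e / 2 <= z
  by rewrite /z le_min lexx andbT; move: zltb; rewrite /z gt_min ltxx /= => /ltW.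
lra.
Qed.

Lemma cdf_is_df (R : realType) (d : measure_display) (Om : measurableType d)
    (P : probability Om R) (X : {RV P >-> R}) (F : R -> R) :
  (forall x : R, (F x)%:E = cdf X x) -> is_df F.
Proof.
move=> hF; have E : fine \o cdf X = F by apply/funext => x /=; rewrite -hF.
split.
- by move=> x y xy; rewrite -lee_fin !hF cdf_nondecreasing.
- by move=> x; have := @cdf_right_continuous _ _ _ P X x; rewrite -hF => /fine_cvgP[_]; rewrite E.
- by have /fine_cvgP[_] := @cvg_cdfNy0 _ _ _ P X; rewrite E.
- by have /fine_cvgP[_] := @cvg_cdfy1 _ _ _ P X; rewrite E.
Qed.

Section absolutely_continuous_df.
Variables (R : realType) (F f : R -> R).
Hypotheses (dF : is_df F) (pF : is_pdf F f).

Lemma df_homo : {homo F : x y / x <= y}. Proof. by case: dF. Qed.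

Lemma df_ge0 (x : R) : 0 <= F x.
Proof.
have [_ f0 E] := pF; rewrite -lee_fin E.
by apply: integral_ge0 => t _; rewrite lee_fin.
Qed.

Lemma df_le1 (x : R) : F x <= 1.
Proof.
have [h _ _ F1] := dF; rewrite -(cvg_lim _ F1)//.
apply: limr_ge; first exact: cvgP F1.
near=> y; apply: h; near: y; apply: nbhs_pinfty_ge; exact: num_real.
Unshelve. all: by end_near. Qed.

Lemma pdf_measurable D : measurable_fun D (EFin \o f).
Proof. by have [mf _ _] := pF; apply/measurable_EFinP; exact: measurable_funTS. Qed.

Lemma pdf_itv (a b : R) : a <= b ->
  (\int[lebesgue_measure]_(t in `]a, b]) (f t)%:E = (F b - F a)%:E)%E.
Proof.
move=> ab; have [mf f0 E] := pF.
have := E b; rewrite (@itv_bndbnd_setU _ _ _ (BRight a)) ?bnd_simp//.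
rewrite ge0_integral_setU//=; last 3 first.
- exact: pdf_measurable.
- by move=> x _; rewrite lee_fin.
- apply/disj_setPS => x [] /=; rewrite !in_itv/= => h /andP[h' _].
  by move: h'; rewrite ltNge h.
(* Its sum with the finite value F a is finite, so the integral over ]a, b] is finite. *)
rewrite -E; case: integral => [v| |]//= [->].
by congr (_%:E); ring.
Qed.

(** On the left, the integrals over ]-oo, x - 1/(n+1)] increase to the integral over ]-oo, x[, and
    the point x itself is negligible. *)
Lemma df_continuous : continuous F.
Proof.
have [homoF rcF _ _] := dF; have [mf f0 E] := pF.
move=> x; apply/left_right_continuousP; split; last exact: rcF.
have x_n n : x - n.+1%:R^-1 < x by rewrite ltrBlDr ltrDl invr_gt0.
pose I n := `]-oo, (x - n.+1%:R^-1 : R)]%classic.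
have : (\int[lebesgue_measure]_(t in I n) (f t)%:E)%E @[n --> \oo] -->
    (\int[lebesgue_measure]_(t in \bigcup_n I n) (f t)%:E)%E.
  apply: ge0_nondecreasing_set_cvg_integral.
  - apply/nondecreasing_seqP => n; rewrite subsetEset => y.
    rewrite /I/= !in_itv/= => /le_trans; apply.
    by rewrite lerD2l lerN2 lef_pV2 ?posrE ?ltr0n// ler_nat.
  - by move=> n; exact: measurable_itv.
  - by move=> n; exact: pdf_measurable.
  - by move=> n y _; rewrite lee_fin.
have -> : \bigcup_n I n = `]-oo, x[%classic.
  apply/seteqP; split => y /=; rewrite in_itv/=.
    by move=> [n _]; rewrite /I/= in_itv/= => /le_lt_trans; apply.
  move=> yx; exists (Num.bound (x - y)^-1) => //; rewrite /I/= in_itv/= lerBrDr -lerBrDl.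
  have xy : 0 < x - y by rewrite subr_gt0.
  rewrite invf_ple ?posrE ?ltr0n//.
  have := archi_boundP (ltW (_ : 0 < (x - y)^-1)); rewrite invr_gt0 => /(_ xy) /ltW/le_trans; apply.
  by rewrite ler_nat.
rewrite integral_itv_bndo_bndc; last exact: pdf_measurable.
rewrite -E; under eq_fun do rewrite /I -E.
move=> /fine_cvgP[_ /= cF].
apply/cvgrPdist_lt => e e0.
have [n _ /(_ n (leqnn n)) Hn] : \forall n \near \oo, `|F x - F (x - n.+1%:R^-1)| < e.
  by move/cvgrPdist_lt : cF; exact.
near=> y.
have yx : y <= x by near: y; exact: nbhs_left_le.
have ny : x - n.+1%:R^-1 <= y by near: y; apply: nbhs_left_ge.
apply: le_lt_trans Hn; rewrite !ger0_norm ?subr_ge0 ?homoF ?(ltW (x_n _))//.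
by rewrite lerD2l lerN2 homoF.
Unshelve. all: by end_near. Qed.

Lemma df_IVT (v x : R) : 0 < v <= F x -> exists2 y, y <= x & F y = v.
Proof.
move=> /andP[v0 vx]; have [homoF _ F0 _] := dF.
have [z zx Fz] : exists2 z, z <= x & F z <= v.
  have : \forall z \near -oo, z <= x /\ F z <= v.
    near=> z; split; first by near: z; apply: nbhs_ninfty_le; exact: num_real.
    apply: ltW; near: z; have /cvgrPdist_lt/(_ v v0) := F0.
    apply: filterS => z; rewrite sub0r normrN; exact: le_lt_trans (ler_norm _).
  by case/filter_ex => z [? ?]; exists z.
have [] := @IVT _ F z x v zx.
- exact/continuous_subspaceT/df_continuous.
- by rewrite ge_min Fz/= le_max vx orbT.
- by move=> y; rewrite in_itv/= => /andP[_ yx] <-; exists y.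
Unshelve. all: by end_near. Qed.

End absolutely_continuous_df.

Section pdf_of_transformed_df.
Variables (R : realType) (F f : R -> R).
Hypotheses (dF : is_df F) (pF : is_pdf F f).
Variables (G h : R -> R).
Hypotheses (Gh : forall p : R, 0 < p <= 1 -> is_derive p 1 G (h p))
  (h0 : forall p : R, 0 < p <= 1 -> 0 <= h p)
  (ch : forall p : R, 0 < p <= 1 -> {for p, continuous h})
  (cG : {for (0 : R), continuous G}) (G0 : G 0 = 0).
Let w (x : R) := if 0 < F x then h (F x) * f x else 0.
Hypothesis mw : measurable_fun [set: R] w.

Let w0 x : 0 <= w x.
Proof.
have [_ f0 _] := pF; rewrite /w; case: ifP => // Fx.
by rewrite mulr_ge0// h0// Fx (df_le1 dF).
Qed.

Let mwE D : measurable_fun D (EFin \o w).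
Proof. by apply/measurable_EFinP; exact: measurable_funTS. Qed.

(** The oscillation of h near F s is kept below e/2, once to bound the integral and once for the
    mean value of h representing G (F y) - G (F x). The existential on v also records that the
    integral is finite. *)
Let integral_near (e s : R) : 0 < e -> 0 < F s -> exists2 d, 0 < d & forall x y,
   0 < F x -> s - d < x -> x <= y -> y < s + d ->
   exists2 v, (\int[lebesgue_measure]_(t in `]x, y]) (w t)%:E = v%:E)%E &
     `|v - (G (F y) - G (F x))| <= e * (F y - F x).
Proof.
move=> e0 Fs; have Fs1 : 0 < F s <= 1 by rewrite Fs (df_le1 dF).
have e20 : 0 < e / 2 by rewrite divr_gt0.
have /cvgrPdist_le/(_ _ e20) : h p @[p --> F s] --> h (F s) by exact: ch.
rewrite near_simpl => /nbhs_ballP[d' /= d'0 H'].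
have /cvgrPdist_lt/(_ _ d'0) : F t @[t --> s] --> F s by exact: df_continuous dF pF _.
move=> /nbhs_ballP[d /= d0 H].
exists d => // x y Fx sx xy ys.
have xd t : x <= t <= y -> `|F s - F t| < d'.
  move=> /andP[xt ty]; apply: H; rewrite /ball/= ltr_distl; apply/andP; split; lra.
have Fxy : F x <= F y by exact: df_homo.
set c := h (F s) in H' *.
have c0 : 0 <= c by apply: h0.
have hc p : F x <= p <= F y -> `|c - h p| <= e / 2.
  move=> /andP[xp py]; apply: H'; rewrite /ball/=.
  have := xd x; have := xd y; rewrite !lexx xy !ltr_distl => /(_ isT)/andP[? ?] /(_ isT)/andP[? ?].
  by apply/andP; split; lra.
have cD D : measurable_fun D (cst c) by exact: measurable_cst.
have [_ f0 _] := pF.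
have mf := @pdf_measurable _ F f pF.
have hF t : x < t <= y -> w t = h (F t) * f t /\ `|c - h (F t)| <= e / 2.
  move=> /andP[xt ty]; have Fxt : F x <= F t by apply: df_homo => //; exact: ltW.
  rewrite /w ifT ?(lt_le_trans Fx)//; split => //.
  by apply: hc; rewrite Fxt df_homo.
set I := (\int[_]_(x in _) _)%E.
have I0 : (0 <= I)%E by apply: integral_ge0 => t _; rewrite lee_fin.
have scale k : 0 <= k ->
    (\int[lebesgue_measure]_(t in `]x, y]) (k%:E * (f t)%:E) = (k * (F y - F x))%:E)%E.
  move=> k0; rewrite ge0_integralZl_EFin//.
  - by rewrite (pdf_itv pF xy).
  - by move=> t _; rewrite lee_fin.
  - exact: mf.
have Iu : (I <= ((c + e / 2) * (F y - F x))%:E)%E.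
  have ce : 0 <= c + e / 2 by lra.
  rewrite -scale//; apply: ge0_le_integral => //.
  - by move=> t _; rewrite lee_fin.
  - exact: mwE.
  - by apply: measurable_funeM; exact: mf.
  - move=> t /=; rewrite in_itv/= => /hF[-> ]; rewrite ler_distl => /andP[? ?].
    by rewrite -EFinM lee_fin ler_wpM2r//; lra.
have Il : (((c - e / 2) * (F y - F x))%:E <= I)%E.
  (* The comparison of integrals is made between nonnegative functions; when c - e/2 is negative,
     the bound follows from I >= 0. *)
  have [ce|ce] := leP 0 (c - e / 2); last first.
    by apply: le_trans I0; rewrite lee_fin mulr_le0_ge0 ?subr_ge0// ltW.
  rewrite -scale//; apply: ge0_le_integral => //.
  - by move=> t _; rewrite -EFinM lee_fin mulr_ge0.
  - by apply: measurable_funeM; exact: mf.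
  - exact: mwE.
  - move=> t /=; rewrite in_itv/= => /hF[-> ]; rewrite ler_distl => /andP[? ?].
    by rewrite -EFinM lee_fin ler_wpM2r//; lra.
move: I0 Iu Il; case: I => [v| |]// _; rewrite !lee_fin => Iu Il.
exists v => //.
have [||z zxy ->] := @MVT_segment _ G h (F x) (F y) Fxy.
- move=> z; rewrite in_itv/= => /andP[xz zy]; apply: Gh.
  by rewrite (lt_trans Fx)// (le_trans (ltW zy))// (df_le1 dF).
- apply: continuous_in_subspaceT => z /[!inE]/= /[!in_itv]/= /andP[xz zy].
  apply: differentiable_continuous; apply/derivable1_diffP.
  have [|//] := Gh (p := z) _; first by rewrite (lt_le_trans Fx)// (le_trans zy)// (df_le1 dF).
have := hc z; move: zxy; rewrite in_itv/= => zxy /(_ zxy); rewrite ler_distl => /andP[z1 z2].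
have D0 : 0 <= F y - F x by rewrite subr_ge0.
rewrite ler_norml; apply/andP; split; nra.
Qed.

(** The error e (F y - F x) is additive over adjacent intervals, so chaining the local estimates
    loses nothing. As F b - F a <= 1, letting e tend to 0 gives equality. *)
Lemma integral_pdf_itv (a b : R) : a <= b -> 0 < F a ->
  (\int[lebesgue_measure]_(t in `]a, b]) (w t)%:E = (G (F b) - G (F a))%:E)%E.
Proof.
move=> ab Fa.
have K e : 0 < e -> exists2 v,
   (\int[lebesgue_measure]_(t in `]a, b]) (w t)%:E = v%:E)%E &
   `|v - (G (F b) - G (F a))| <= e * (F b - F a).
  move=> e0; pose P x y := exists2 v,
   (\int[lebesgue_measure]_(t in `]x, y]) (w t)%:E = v%:E)%E &
   `|v - (G (F y) - G (F x))| <= e * (F y - F x).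
  apply: (@interval_chain_ind _ P) => //.
    move=> x y z /andP[ax xy] /andP[yz zb] [v1 E1 H1] [v2 E2 H2].
    exists (v1 + v2).
      rewrite (@itv_bndbnd_setU _ _ _ (BRight y)) ?bnd_simp//.
      rewrite ge0_integral_setU//=.
      - by rewrite E1 E2.
      - exact: mwE.
      - by move=> t _; rewrite lee_fin.
      - apply/disj_setPS => t [] /=; rewrite !in_itv/= => /andP[_ h1] /andP[h2 _].
        by move: h2; rewrite ltNge h1.
    by move: H1 H2; rewrite !ler_norml => /andP[? ?] /andP[? ?]; apply/andP; split; lra.
  move=> s /andP[as_ sb].
  have Fs : 0 < F s by apply: lt_le_trans Fa _; exact: df_homo.
  have [d d0 H] := integral_near e0 Fs.
  exists d => // x y ax yb sx xy ys; apply: H => //.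
  by apply: lt_le_trans Fa _; exact: df_homo.
have [v E _] := K 1 ltr01; rewrite E; congr (_%:E).
apply/eqP; rewrite -subr_eq0 -normr_le0; apply/ler_addgt0Pl => e e0.
have e10 : 0 < e / 2 by rewrite divr_gt0.
have [v' ] := K _ e10; rewrite E => -[<-] /le_trans; apply.
rewrite addr0.
have := df_le1 dF b; have := df_ge0 pF a; nra.
Qed.

(** The formula on ]a, b] requires F a > 0, while F may vanish on a half-line. Taking F a_n = F x /
    (n + 2) exhausts the part of ]-oo, x] where F > 0, and G (F a_n) tends to G 0 = 0. *)
Lemma is_pdf_transform : is_pdf (G \o F) w.
Proof.
split => // x; rewrite /=.
have [homoF _ F0 _] := dF.
have [Fx|Fx] := ltP 0 (F x); last first.
  have -> : F x = 0 by apply/eqP; rewrite eq_le Fx (df_ge0 pF).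
  rewrite G0 integral0_eq// => t /=; rewrite in_itv/= => tx; rewrite /w ifF//.
  by apply/negbTE; rewrite -leNgt (le_trans _ Fx)// homoF.
have /choice[a Ha] : forall n : nat, exists y, y <= x /\ F y = F x / n.+2%:R.
  move=> n; have [|y yx <-] := @df_IVT _ F f dF pF (F x / n.+2%:R) x; last by exists y.
  by rewrite divr_gt0//= ler_pdivrMr// ler_peMr ?(ltW Fx)// ler1n.
pose I n := `]a n, x]%classic.
have : (\int[lebesgue_measure]_(t in I n) (w t)%:E)%E @[n --> \oo] -->
    (\int[lebesgue_measure]_(t in \bigcup_n I n) (w t)%:E)%E.
  apply: ge0_nondecreasing_set_cvg_integral.
  - apply/nondecreasing_seqP => n; rewrite subsetEset => y; rewrite /I/= !in_itv/= => /andP[ay ->].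
    rewrite andbT (le_lt_trans _ ay)// leNgt; apply/negP => /ltW/homoF.
    have [_ ->] := Ha n; have [_ ->] := Ha n.+1.
    by rewrite ler_pM2l// lef_pV2 ?posrE// ler_nat ltnn.
  - by move=> n; exact: measurable_itv.
  - by move=> n; exact: mwE.
  - by move=> n y _; rewrite lee_fin.
have -> : (\int[lebesgue_measure]_(t in \bigcup_n I n) (w t)%:E =
    \int[lebesgue_measure]_(t in `]-oo, x]) (w t)%:E)%E.
  rewrite integral_mkcond [RHS]integral_mkcond; apply: eq_integral => t _.
  (* Points with F t = 0 lie in no [I n], but [w] vanishes there. *)
  rewrite !patchE; have [Ft|Ft] := ltP 0 (F t); last first.
    by rewrite (_ : w t = 0) ?if_same// /w ltNge Ft.
  have -> // : (t \in \bigcup_n I n) = (t \in `]-oo, x]%classic).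
  apply/idP/idP => /[!inE].
    by move=> [n _]; rewrite /I/= !in_itv/= => /andP[].
  rewrite /= in_itv/= => tx; exists (Num.bound (F x / F t)) => //.
  rewrite /I/= in_itv/= tx andbT ltNge; apply/negP => /homoF.
  set n := Num.bound _; have [_ ->] := Ha n.
  rewrite leNgt => /negP; apply; rewrite ltr_pdivrMr// mulrC -ltr_pdivrMr//.
  by rewrite (lt_trans (archi_boundP (divr_ge0 (ltW Fx) (ltW Ft))))// ltr_nat.
have E n : (\int[lebesgue_measure]_(t in I n) (w t)%:E = (G (F x) - G (F x / n.+2%:R))%:E)%E.
  have [ax Fa] := Ha n; rewrite -Fa; apply: integral_pdf_itv => //.
  by rewrite Fa divr_gt0.
under eq_fun do rewrite E.
move=> cI; apply: (cvg_unique _ _ cI) => //.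
apply: cvg_EFin; first exact: nearW.
rewrite -[X in _ --> X]subr0 -[X in _ - X]G0.
apply: cvgB; first exact: cvg_cst.
apply: (@cvg_comp _ _ _ (fun n => F x / n.+2%:R) G _ (nbhs (0 : R))) => //.
rewrite -(mulr0 (F x)); apply: cvgM; first exact: cvg_cst.
by have := @cvg_harmonic R; rewrite -(@cvg_shiftS R^o (@harmonic R)).
Qed.

End pdf_of_transformed_df.

(** * The tail of T_k *)

Section right_end.
Variables (R : realType) (F : R -> R).
Hypotheses (dF : is_df F) (cF : continuous F).

(** If F a < 1 at a finite right end a, continuity would give F < 1 slightly beyond a. So F reaches
    1 exactly at a. *)
Lemma right_extremity_cases :
  (right_extremity F = +oo%E /\ forall x, F x < 1) \/
  (exists a, [/\ right_extremity F = a%:E, F a = 1 & forall x, (F x < 1) = (x < a)]).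
Proof.
have [homoF _ F0 F1] := dF.
have [x0 Fx0] : exists x, F x < 1.
  have : \forall z \near -oo, F z < 1.
    have /cvgrPdist_lt/(_ 1 ltr01) := F0.
    apply: filterS => z; rewrite sub0r normrN; exact: le_lt_trans (ler_norm _).
  by case/filter_ex => z ?; exists z.
have x0r : (x0%:E <= right_extremity F)%E by apply: ereal_sup_ubound; exists x0.
have lt1 x : (x%:E < right_extremity F)%E -> F x < 1.
  move=> /ereal_sup_gt[_ [y /= Fy <-]]; rewrite lte_fin => xy.
  by apply: le_lt_trans Fy; apply: homoF; exact: ltW.
case E : (right_extremity F) => [a| |].
- right; exists a.
  have Fa : F a = 1.
    apply/eqP; rewrite eq_le (df_le1 dF)/= leNgt; apply/negP => Fa1.
    have : \forall x \near a, F x < 1.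
      have /cvgrPdist_lt/(_ (1 - F a)) : F t @[t --> a] --> F a by exact: cF.
      rewrite subr_gt0 => /(_ Fa1); apply: filterS => x; rewrite distrC ltr_norml => /andP[_]; lra.
    move=> /nbhs_ballP[e /= e0 He].
    have : F (a + e / 2) < 1.
      by apply: He; rewrite /ball/= opprD addNKr normrN gtr0_norm ?divr_gt0//; lra.
    move=> h; have : ((a + e / 2)%:E <= right_extremity F)%E.
      by apply: ereal_sup_ubound; exists (a + e / 2).
    by rewrite E lee_fin; lra.
  split => // x; apply/idP/idP => [Fx|xa]; last by apply: lt1; rewrite E lte_fin.
  by rewrite ltNge; apply/negP => /homoF; rewrite Fa leNgt Fx.
- by left; split => // x; apply: lt1; rewrite E ltry.
- by move: x0r; rewrite E.
Qed.

Lemma right_extremity_gtP (x : R) : (x%:E < right_extremity F)%E <-> F x < 1.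
Proof.
case: right_extremity_cases => [[-> h]|[a [-> _ ->]]]; last by rewrite lte_fin.
by split => _ //; rewrite ltry.
Qed.

Lemma left_filter_proper : ProperFilter (left_filter (right_extremity F)).
Proof.
by case: right_extremity_cases => [[-> _]|[a [-> _ _]]] /=; exact: _.
Qed.

Lemma left_filter_lt1 : \forall x \near left_filter (right_extremity F), F x < 1.
Proof.
case: right_extremity_cases => [[-> h]|[a [-> _ h]]] /=; first exact: nearW.
by near=> x; rewrite h; near: x; exact: nbhs_left_lt.
Unshelve. all: by end_near. Qed.

Lemma left_filter_cvg1 : F x @[x --> left_filter (right_extremity F)] --> (1 : R).
Proof.
case: right_extremity_cases => [[-> h]|[a [-> <- h]]] /=; first by have [] := dF.
by apply: cvg_at_left_filter; exact: cF.
Qed.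

(** Every x with F x < 1 is eventually exceeded by c, since F c tends to 1 and F is monotone; F c <
    1 keeps c below a finite right end. *)
Lemma cvg_left_filter (I : Type) (H : set_system I) {FH : Filter H} (c : I -> R) :
  (\forall i \near H, F (c i) < 1) -> F (c i) @[i --> H] --> (1 : R) ->
  c i @[i --> H] --> left_filter (right_extremity F).
Proof.
have [homoF _ _ _] := dF.
move=> c1 Fc; have Hx x : F x < 1 -> \forall i \near H, x < c i.
  move=> Fx; have : \forall i \near H, F x < F (c i).
    have /cvgrPdist_lt/(_ (1 - F x)) := Fc; rewrite subr_gt0 => /(_ Fx).
    by apply: filterS => i; rewrite ltr_norml => /andP[_]; lra.
  by apply: filterS => i; rewrite !ltNge; apply: contra => /homoF.
case: right_extremity_cases => [[-> h]|[a [-> Fa h]]] /=.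
  by apply/cvgryPgt => x; exact: Hx.
move=> A /= [e /= e0 He]; suff : \forall i \near H, A (c i) by [].
near=> i; apply: He; last first.
  by rewrite -h; near: i.
have : a - e < c i by near: i; apply: Hx; rewrite h; lra.
have : c i < a by rewrite -h; near: i.
by rewrite /ball/= => ? ?; rewrite gtr0_norm; lra.
Unshelve. all: by end_near. Qed.

End right_end.

Lemma eq_right_extremity (R : realType) (A B : R -> R) :
  (forall x, (A x < 1) = (B x < 1)) -> right_extremity A = right_extremity B.
Proof.
move=> AB; congr ereal_sup; apply/seteqP; split => _ [x /= h <-]; exists x => //=.
  by rewrite -AB.
by rewrite AB.
Qed.

Section Tk_tail.
Variables (R : realType) (F f : R -> R) (r : R) (k : nat).
Hypotheses (dF : is_df F) (pF : is_pdf F f) (r0 : 0 < r) (k0 : (0 < k)%N).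
Let T := Tk r k F.
Let cF := df_continuous dF pF.

Let TE x : T x = nbG r k (F x). Proof. by []. Qed.

Lemma Tk_continuous : continuous T.
Proof.
move=> x; apply: (@continuous_comp _ _ _ F (nbG r k)); first exact: cF.
by apply: continuous_nbG => //; exact: df_le1.
Qed.

Lemma Tk_is_df : is_df T.
Proof.
have [homoF _ F0 F1] := dF; split.
- by move=> x y xy; rewrite !TE nbG_homo ?inE ?df_le1// homoF.
- by move=> x; apply: cvg_at_right_filter; exact: Tk_continuous.
- apply: (@cvg_comp _ _ _ F (nbG r k) _ _ _ F0); have := @continuous_nbG _ r k r0 0 ler01.
  by rewrite /prop_for /continuous_at (_ : nbG r k 0 = 0)// /nbG ltxx.
- apply: (@cvg_comp _ _ _ F (nbG r k) _ _ _ F1); have := @continuous_nbG _ r k r0 1 (lexx _).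
  by rewrite /prop_for /continuous_at nbG1.
Qed.

Lemma Tk_is_pdf : is_pdf T (tk r k F f).
Proof.
have kB : 1 / Beta r k%:R = k%:R * nbcoef r k.
  have : Beta r k%:R != 0 by rewrite gt_eqF ?Beta_gt0.
  rewrite -[nbcoef r k]invrK -Beta_nbcoef// => B0.
  by field; rewrite B0 pnatr_eq0 -lt0n.
have E : tk r k F f = fun x => if 0 < F x then nbh r k (F x) * f x else 0.
  by apply/funext => x; rewrite /tk kB /nbh; case: ifP => // _; ring.
rewrite E; apply: (@is_pdf_transform _ F f dF pF (nbG r k)).
- by move=> p p01; exact: is_derive_nbG.
- by move=> p p01; exact: nbh_ge0.
- move=> p /andP[p0 p1]; have u0 : 0 <= - ln p by rewrite oppr_ge0 ln_le0.
  have cl := continuous_ln p0.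
  apply: cvgM; first by apply: cvgM; [exact: cvg_cst|apply: cvgV => //; rewrite gt_eqF].
  apply: cvgM.
    apply: (@cvg_comp _ _ _ (fun x : R => - ln x) (fun u => u ^+ k.-1)); first exact: cvgN cl.
    exact: exprn_continuous.
  apply: cvgV; first by rewrite gt_eqF// powR_gt0//; lra.
  apply: (@cvg_comp _ _ _ (fun x : R => 1 - ln x) (fun u => u `^ (r + k%:R))).
    by apply: cvgB; [exact: cvg_cst|exact: cl].
  by apply: continuous_powRl; lra.
- exact: continuous_nbG.
- by rewrite /nbG ltxx.
- have [mf _ _] := pF.
  have mF : measurable_fun [set: R] F by exact: continuous_measurable_fun.
  (* This writes the quotients in [nbh] as real powers, whose measurability holds on the whole line;
     the two agree where F x > 0. *)
  pose h0 (p : R) := k%:R * nbcoef r k * p `^ (-1) *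
    ((- ln p) ^+ k.-1 * (1 - ln p) `^ (- (r + k%:R))).
  have mh0 : measurable_fun [set: R] h0.
    have mln : measurable_fun [set: R] (@ln R) by exact: measurable_ln.
    apply: measurable_funM; first by apply: measurable_funM => //; exact: measurable_powR.
    apply: measurable_funM; first by apply: measurable_funX; exact: measurableT_comp.
    apply: (@measurableT_comp _ _ _ _ _ _ (fun u : R => u `^ (- (r + k%:R)))).
      exact: measurable_powR.
    exact: measurable_funB.
  rewrite (_ : (fun x => _) = fun x => if 0 < F x then h0 (F x) * f x else 0); last first.
    apply/funext => x; case: ifP => // Fx.
    by rewrite /nbh /h0 powRN (powR_inv1 (ltW Fx)).
  apply: measurable_fun_ifT => //; first exact: measurable_fun_ltr.
  by apply: measurable_funM => //; exact: measurableT_comp.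
Qed.

Lemma Tk_lt1 x : (T x < 1) = (F x < 1).
Proof. by rewrite TE nbG_lt1// df_le1. Qed.

Lemma Tk_right_extremity : right_extremity T = right_extremity F.
Proof. exact/eq_right_extremity/Tk_lt1. Qed.

Lemma Tk_tail_ratio : (fun x => (1 - T x) / (1 - F x) ^+ k)
  @ left_filter (right_extremity F) --> nbcoef r k.
Proof.
have [K cK EK] := nbG_tail r0 k0.
have pf := left_filter_proper dF cF.
have : (K \o F) x @[x --> left_filter (right_extremity F)] --> nbcoef r k.
  exact: cvg_comp (left_filter_cvg1 dF cF) cK.
apply: cvg_trans; apply: near_eq_cvg.
apply: filterS (left_filter_lt1 dF cF) => x Fx.
by rewrite /= TE EK ?df_le1// mulfK// expf_neq0// gt_eqF// subr_gt0.
Qed.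

Lemma Tk_tail_equivalent : tail_equivalent T (Hk k F).
Proof.
have H1 x : (Hk k F x < 1) = (F x < 1).
  rewrite /Hk; have := df_le1 dF x; rewrite le_eqVlt => /predU1P[->|F1].
    by rewrite subrr expr0n gtn_eqF// subr0 ltxx.
  by rewrite F1 gtrBl exprn_gt0// subr_gt0.
split; first by rewrite Tk_right_extremity; exact/esym/eq_right_extremity.
exists (nbcoef r k); first exact: nbcoef_gt0.
rewrite Tk_right_extremity; have := Tk_tail_ratio.
by under eq_fun do rewrite -[in X in _ / X](subKr 1 ((1 - F _) ^+ k)).
Qed.

(* The tail of T is asymptotically a multiple of the kth power of that of F, so
   a limit for the latter with norming M gives one for T with norming M^k. *)
Lemma Tk_tail_transfer (I : Type) (H : set_system I) {FH : Filter H}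
    (M : I -> R) (z : I -> R) (l : R) :
  F (z i) @[i --> H] --> (1 : R) -> M i * (1 - F (z i)) @[i --> H] --> l ->
  M i ^+ k * (1 - T (z i)) @[i --> H] --> nbcoef r k * l ^+ k.
Proof.
move=> F1 Ml; have [K cK EK] := nbG_tail r0 k0.
have E i : M i ^+ k * (1 - T (z i)) = K (F (z i)) * (M i * (1 - F (z i))) ^+ k.
  by rewrite TE EK ?df_le1// exprMn; ring.
under eq_fun do rewrite E.
apply: cvgM; first exact: cvg_comp F1 cK.
apply: (@cvg_comp _ _ _ (fun i => M i * (1 - F (z i))) (fun x => x ^+ k) _ _ _ Ml).
exact: exprn_continuous.
Qed.

End Tk_tail.

(** * Convergence of norming constants *)

Section norming.
Variables (R : realType) (I : Type) (H : set_system I).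
Context {FH : Filter H}.
Variables (N : I -> R -> R) (a b : I -> R) (rho : R -> R) (x0 : R).
Hypotheses (N_anti : forall i, {homo N i : x y /~ x <= y})
  (a_gt0 : \forall i \near H, 0 < a i)
  (N_cvg : \forall x \near x0, N i (a i * x + b i) @[i --> H] --> rho x).

Lemma norming_cvg_inv (c : I -> R) :
  (\forall x \near x0, (x < x0 -> rho x0 < rho x) /\ (x0 < x -> rho x < rho x0)) ->
  N i (c i) @[i --> H] --> rho x0 -> (c i - b i) / a i @[i --> H] --> x0.
Proof.
move=> rho_decr Nc; apply/cvgrPdist_lt => e e0.
have [e1 /= e10 He] : exists2 e1 : R, 0 < e1 & forall x, `|x0 - x| < e1 ->
    N i (a i * x + b i) @[i --> H] --> rho x /\
    ((x < x0 -> rho x0 < rho x) /\ (x0 < x -> rho x < rho x0)).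
  have : \forall x \near x0, N i (a i * x + b i) @[i --> H] --> rho x /\
    ((x < x0 -> rho x0 < rho x) /\ (x0 < x -> rho x < rho x0)) by exact: filterI.
  by move=> /nbhs_ballP[e1 /= ? He]; exists e1.
pose d := Num.min e e1 / 2.
have d0 : 0 < d by rewrite divr_gt0// lt_min e0.
have de : d < e by rewrite /d; have := ge_min e e e1; rewrite lexx /=; lra.
have de1 : d < e1 by rewrite /d; have := ge_min e1 e e1; rewrite lexx orbT; lra.
have [|Np [_ /(_ _)rp]] := He (x0 + d); first by rewrite opprD addNKr normrN gtr0_norm.
have [|Nm [/(_ _)rm _]] := He (x0 - d); first by rewrite subKr gtr0_norm.
have sep (u v : I -> R) (l m : R) : u i @[i --> H] --> l -> v i @[i --> H] --> m -> l < m ->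
    \forall i \near H, u i < v i.
  move=> ul vm lm; near=> i.
  have h1 : `|l - u i| < (m - l) / 2.
    by near: i; move/cvgrPdist_lt : ul; apply; rewrite divr_gt0// subr_gt0.
  have h2 : `|m - v i| < (m - l) / 2.
    by near: i; move/cvgrPdist_lt : vm; apply; rewrite divr_gt0// subr_gt0.
  by move: h1 h2; rewrite !ltr_norml => /andP[? ?] /andP[? ?]; lra.
have cp : \forall i \near H, c i < a i * (x0 + d) + b i.
  have : \forall i \near H, N i (a i * (x0 + d) + b i) < N i (c i).
    by apply: sep Np Nc _; apply: rp; rewrite ltrDl.
  by apply: filterS => i; rewrite !ltNge; apply: contra; exact: N_anti.
have cm : \forall i \near H, a i * (x0 - d) + b i < c i.
  have : \forall i \near H, N i (c i) < N i (a i * (x0 - d) + b i).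
    by apply: sep Nc Nm _; apply: rm; rewrite gtrBl.
  by apply: filterS => i; rewrite !ltNge; apply: contra; exact: N_anti.
near=> i.
have ai : 0 < a i by near: i.
have h1 : (c i - b i) / a i < x0 + d.
  by rewrite ltr_pdivrMr// ltrBlDr mulrC; near: i.
have h2 : x0 - d < (c i - b i) / a i.
  by rewrite ltr_pdivlMr// ltrBrDr mulrC; near: i.
by rewrite ltr_norml; apply/andP; split; lra.
Unshelve. all: by end_near. Qed.

(** Monotonicity takes the place of locally uniform convergence: N_i (c_i) is squeezed between the
    values of N_i at a_i (x0 + d) + b_i and a_i (x0 - d) + b_i, whose limits are close to rho x0. *)
Lemma norming_cvg (c : I -> R) : {for x0, continuous rho} ->
  (c i - b i) / a i @[i --> H] --> x0 -> N i (c i) @[i --> H] --> rho x0.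
Proof.
move=> crho cx; apply/cvgrPdist_lt => e e0.
have e20 : 0 < e / 2 by rewrite divr_gt0.
have [e1 /= e10 He] : exists2 e1 : R, 0 < e1 & forall x, `|x0 - x| < e1 ->
    N i (a i * x + b i) @[i --> H] --> rho x /\ `|rho x0 - rho x| < e / 2.
  have /cvgrPdist_lt/(_ _ e20) h : rho x @[x --> x0] --> rho x0 by exact: crho.
  have : \forall x \near x0, N i (a i * x + b i) @[i --> H] --> rho x /\
    `|rho x0 - rho x| < e / 2 by exact: filterI.
  by move=> /nbhs_ballP[e1 /= ? He]; exists e1.
pose d := e1 / 2; have d0 : 0 < d by rewrite divr_gt0.
have de1 : d < e1 by rewrite /d; lra.
have [|Np rp] := He (x0 + d); first by rewrite opprD addNKr normrN gtr0_norm.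
have [|Nm rm] := He (x0 - d); first by rewrite subKr gtr0_norm.
near=> i.
have ai : 0 < a i by near: i.
have ci : `|x0 - (c i - b i) / a i| < d by near: i; move/cvgrPdist_lt : cx; exact.
have h1 : `|rho (x0 + d) - N i (a i * (x0 + d) + b i)| < e / 2.
  by near: i; move/cvgrPdist_lt : Np; exact.
have h2 : `|rho (x0 - d) - N i (a i * (x0 - d) + b i)| < e / 2.
  by near: i; move/cvgrPdist_lt : Nm; exact.
have [l1 l2] : N i (a i * (x0 + d) + b i) <= N i (c i) /\ N i (c i) <= N i (a i * (x0 - d) + b i).
  move: ci; rewrite ltr_distlC => /andP[h3 h4]; split; apply: N_anti.
    by rewrite mulrC -lerBlDr -ler_pdivrMr// ltW.
  by rewrite mulrC -lerBrDr -ler_pdivlMr// ltW.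
move: h1 h2 rp rm; rewrite !ltr_norml => /andP[? ?] /andP[? ?] /andP[? ?] /andP[? ?].
by apply/andP; split; lra.
Unshelve. all: by end_near. Qed.

End norming.

Section exponential_limits.
Variable R : realType.

(** By [oppln_bounds], - n ln (y_n) lies between n (1 - y_n) and n (1 - y_n) / y_n, and y_n tends to
    1. *)
Lemma cvg_pow_expR (y : nat -> R) (l : R) : (forall n, y n <= 1) ->
  n%:R * (1 - y n) @[n --> \oo] --> l -> y n ^+ n @[n --> \oo] --> expR (- l).
Proof.
move=> y1 yl.
have y_cvg1 : y n @[n --> \oo] --> (1 : R).
  have h : (n%:R * (1 - y n)) * n%:R^-1 @[n --> \oo] --> l * 0.
    apply: cvgM => //; rewrite -(@cvg_shiftS R^o (fun n => n%:R^-1)).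
    exact: (@cvg_harmonic R).
  have : 1 - (n%:R * (1 - y n)) * n%:R^-1 @[n --> \oo] --> 1 - l * 0.
    by apply: cvgB => //; exact: cvg_cst.
  rewrite mulr0 subr0; apply: cvg_trans; apply: near_eq_cvg; near=> n.
  have n0 : n%:R != 0 :> R by rewrite pnatr_eq0 -lt0n; near: n; exact: nbhs_infty_gt.
  by field.
have y_gt0 : \forall n \near \oo, 0 < y n.
  have /cvgrPdist_lt/(_ 1 ltr01) := y_cvg1; apply: filterS => n.
  by rewrite ltr_norml => /andP[_]; lra.
have nln : n%:R * (- ln (y n)) @[n --> \oo] --> l.
  have up : n%:R * (1 - y n) / y n @[n --> \oo] --> l.
    by rewrite -[X in _ --> X]divr1; apply: cvgM => //; apply: cvgV; rewrite ?oner_eq0.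
  apply: squeeze_cvgr yl up; near=> n.
  have yn : 0 < y n by near: n.
  have /andP[h1 h2] := oppln_bounds yn.
  by rewrite -mulrA !ler_wpM2l// ?ler0n.
have : expR (- (n%:R * (- ln (y n)))) @[n --> \oo] --> expR (- l).
  by apply: continuous_cvg; [exact: continuous_expR|exact: cvgN].
apply: cvg_trans; apply: near_eq_cvg; near=> n.
have yn : 0 < y n by near: n.
by rewrite mulrN opprK mulrC expRM_natr lnK.
Unshelve. all: by end_near. Qed.

(** The limit being positive, y_n > 0 eventually and logarithms can be taken: ln (y_n) is of order
    1/n, so y_n tends to 1, and n (1 - y_n) lies between - n y_n ln (y_n) and - n ln (y_n). *)
Lemma cvg_pow_expR_inv (y : nat -> R) (l : R) : (forall n, 0 <= y n <= 1) ->
  y n ^+ n @[n --> \oo] --> expR (- l) -> n%:R * (1 - y n) @[n --> \oo] --> l.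
Proof.
move=> y01 yl.
have y_gt0 : \forall n \near \oo, 0 < y n.
  near=> n; have n0 : (0 < n)%N by near: n; exact: nbhs_infty_gt.
  rewrite lt_def; have /andP[-> _] := y01 n; rewrite andbT.
  have : 0 < y n ^+ n.
    near: n; have /cvgrPdist_lt/(_ _ (expR_gt0 (- l))) := yl; apply: filterS => n.
    by rewrite ltr_norml => /andP[_]; lra.
  by apply: contraTneq => ->; rewrite expr0n gtn_eqF// ltxx.
have nln : n%:R * (- ln (y n)) @[n --> \oo] --> l.
  have : - ln (y n ^+ n) @[n --> \oo] --> - ln (expR (- l)).
    by apply: cvgN; apply: continuous_cvg => //; apply: continuous_ln; exact: expR_gt0.
  rewrite expRK opprK; apply: cvg_trans; apply: near_eq_cvg; near=> n.
  have yn : 0 < y n by near: n.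
  by rewrite lnXn// mulr_natl mulNrn.
have lny0 : ln (y n) @[n --> \oo] --> (0 : R).
  have h : n%:R * (- ln (y n)) * n%:R^-1 @[n --> \oo] --> l * 0.
    apply: cvgM => //; rewrite -(@cvg_shiftS R^o (fun n => n%:R^-1)).
    exact: (@cvg_harmonic R).
  have : - (n%:R * (- ln (y n)) * n%:R^-1) @[n --> \oo] --> - (l * 0) by exact: cvgN.
  rewrite mulr0 oppr0; apply: cvg_trans; apply: near_eq_cvg; near=> n.
  have n0 : n%:R != 0 :> R by rewrite pnatr_eq0 -lt0n; near: n; exact: nbhs_infty_gt.
  by field.
have y_cvg1 : y n @[n --> \oo] --> (1 : R).
  rewrite -(@expR0 R); have : expR (ln (y n)) @[n --> \oo] --> expR (0 : R).
    by apply: continuous_cvg => //; exact: continuous_expR.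
  apply: cvg_trans; apply: near_eq_cvg; near=> n.
  by rewrite lnK// posrE; near: n.
have lo : n%:R * (- ln (y n)) * y n @[n --> \oo] --> l.
  by rewrite -[X in _ --> X]mulr1; exact: cvgM.
apply: squeeze_cvgr lo nln; near=> n.
have yn : 0 < y n by near: n.
have /andP[h1 h2] := oppln_bounds yn.
rewrite -mulrA; apply/andP; split; apply: ler_wpM2l; rewrite ?ler0n//.
by rewrite -ler_pdivlMr.
Unshelve. all: by end_near. Qed.

(** The integer N = floor (1 / p) satisfies 1 - p < N p <= 1. This carries limits along the integers
    over to arbitrary points near the right end. *)
Lemma truncn_inv_cvg (I : Type) (H : set_system I) {FH : Filter H} (p : I -> R) :
  (\forall i \near H, 0 < p i) -> p i @[i --> H] --> (0 : R) ->
  Num.truncn (p i)^-1 @[i --> H] --> \oo /\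
  (Num.truncn (p i)^-1)%:R * p i @[i --> H] --> (1 : R).
Proof.
move=> p_gt0 p0.
have B i : 0 < p i -> (Num.truncn (p i)^-1)%:R <= (p i)^-1 < (Num.truncn (p i)^-1).+1%:R.
  by move=> pi; apply: truncn_itv; rewrite invr_ge0 ltW.
split.
  apply/cvgnyPge => n; near=> i.
  have pi : 0 < p i by near: i.
  have /andP[_ h] := B i pi; rewrite -ltnS -(ltr_nat R); apply: lt_trans h.
  rewrite -(ltr_pM2r pi) mulVf ?gt_eqF//.
  have : p i < n.+1%:R^-1.
    near: i; have /cvgrPdist_lt/(_ n.+1%:R^-1) := p0; rewrite invr_gt0 ltr0n => /(_ isT).
    by apply: filterS => i; rewrite sub0r normrN; exact: le_lt_trans (ler_norm _).
  have n0 : 0 < n.+1%:R :> R by rewrite ltr0n.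
  rewrite -[n.+1%:R^-1]mul1r ltr_pdivlMr// mulrC; apply: le_lt_trans.
  by rewrite ler_pM2r// ler_nat.
have lo : 1 - p i @[i --> H] --> (1 : R).
  by rewrite -[X in _ --> X]subr0; apply: cvgB => //; exact: cvg_cst.
apply: squeeze_cvgr lo (cvg_cst _); near=> i.
have pi : 0 < p i by near: i.
have /andP[h1 h2] := B i pi; apply/andP; split.
  by move: h2; rewrite -natr1 -(ltr_pM2r pi) mulVf ?gt_eqF// mulrDl mul1r; lra.
by rewrite -ler_pdivlMr// mul1r.
Unshelve. all: by end_near. Qed.

(** Fix t < t' < 1. If u <= B eventually, the choice e = (t' - t) B gives u <= t' B eventually, so
    starting from a global bound M every t'^j M is an eventual bound. *)
Lemma halving_contraction_cvg0 (u : nat -> R) (t : R) : 0 <= t < 1 ->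
  (forall n, 0 <= u n) ->
  (forall e, 0 < e -> \forall m \near \oo, u m <= t * u m./2 + e) ->
  u n @[n --> \oo] --> (0 : R).
Proof.
move=> /andP[t0 t1] u0 ut; pose t' := (1 + t) / 2.
have t'0 : 0 < t' by rewrite /t'; lra.
have t'1 : t' < 1 by rewrite /t'; lra.
have tt' : 0 < t' - t by rewrite /t'; lra.
have [M M1 uM] : exists2 M, 1 <= M & forall m, u m <= M.
  (* The error 1 - t makes any bound M >= 1 stable under the recurrence: t M + 1 - t <= M. *)
  have [m0 _ um0] : \forall m \near \oo, u m <= t * u m./2 + (1 - t) by apply: ut; lra.
  pose S := \sum_(i < m0.+1) u i.
  have S0 : 0 <= S by exact: sumr_ge0.
  exists (1 + S); first by lra.
  elim/ltn_ind => m IH; have [mm0|mm0] := ltnP m m0.+1.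
    suff : u m <= S by lra.
    by rewrite /S (bigD1 (Ordinal mm0))//= lerDl sumr_ge0.
  have mh : (m./2 < m)%N by rewrite -divn2 ltn_Pdiv// (leq_ltn_trans _ mm0).
  have := um0 m (ltnW mm0) => /le_trans; apply.
  have := IH _ mh; nra.
have pw j : \forall m \near \oo, u m <= t' ^+ j * M.
  elim: j => [|j [m1 _ IH]]; first by rewrite expr0 mul1r; exact: nearW.
  have K0 : 0 < t' ^+ j * M by rewrite mulr_gt0 ?exprn_gt0//; lra.
  near=> m.
  have h1 : u m <= t * u m./2 + (t' - t) * (t' ^+ j * M).
    by near: m; apply: ut; rewrite mulr_gt0.
  have h2 : u m./2 <= t' ^+ j * M.
    by apply: IH; rewrite /= -[m1]doubleK half_leq//; near: m; exact: nbhs_infty_ge.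
  rewrite exprS -mulrA; apply: le_trans h1 _.
  by have := ler_wpM2l t0 h2; set K := t' ^+ j * M; lra.
apply/cvgrPdist_lt => e e0.
have : t' ^+ j * M @[j --> \oo] --> 0 * M.
  by apply: cvgM; [apply: cvg_expr; rewrite gtr0_norm|exact: cvg_cst].
rewrite mul0r => /cvgrPdist_lt/(_ e e0)[j _ /(_ j (leqnn j))].
rewrite sub0r normrN => je; apply: filterS (pw j) => m um.
by rewrite sub0r normrN ger0_norm// (le_lt_trans um)// (le_lt_trans _ je)// ler_norm.
Unshelve. all: by end_near. Qed.

End exponential_limits.

Lemma cvg_ratio (R : realType) (I : Type) (H : set_system I) {FH : Filter H}
    (M u w : I -> R) (l : R) :
  M i * u i @[i --> H] --> l -> M i * w i @[i --> H] --> (1 : R) ->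
  u i / w i @[i --> H] --> l.
Proof.
move=> Mu Mw; have : M i * u i / (M i * w i) @[i --> H] --> l / 1.
  by apply: cvgM => //; apply: cvgV; rewrite ?oner_eq0.
rewrite divr1; apply: cvg_trans; apply: near_eq_cvg.
have /cvgrPdist_lt/(_ 1 ltr01) := Mw; apply: filterS => i h.
have : M i * w i != 0 by apply: contraTneq h => ->; rewrite subr0 normr1 ltxx.
by rewrite mulf_eq0 negb_or => /andP[? ?]; field; apply/andP.
Qed.

Lemma cvg_ratio_inv (R : realType) (I : Type) (H : set_system I) {FH : Filter H}
    (M u w : I -> R) (l : R) :
  u i / w i @[i --> H] --> l -> M i * w i @[i --> H] --> (1 : R) ->
  M i * u i @[i --> H] --> l.
Proof.
move=> uw Mw; have : M i * w i * (u i / w i) @[i --> H] --> 1 * l by exact: cvgM.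
rewrite mul1r; apply: cvg_trans; apply: near_eq_cvg.
have /cvgrPdist_lt/(_ 1 ltr01) := Mw; apply: filterS => i h.
have : M i * w i != 0 by apply: contraTneq h => ->; rewrite subr0 normr1 ltxx.
by rewrite mulf_eq0 negb_or => /andP[? ?]; field.
Qed.

Lemma cvg_half : m./2 @[m --> \oo] --> \oo.
Proof.
apply/cvgnyPge => n; near=> m; rewrite -[n]doubleK half_leq//.
by near: m; exact: nbhs_infty_ge.
Unshelve. all: by end_near. Qed.

Lemma cvg_half_ratio (R : realType) :
  (m./2)%:R / m%:R @[m --> \oo] --> (2^-1 : R).
Proof.
have h : m%:R^-1 @[m --> \oo] --> (0 : R).
  by rewrite -(@cvg_shiftS R^o (fun n => n%:R^-1)); exact: (@cvg_harmonic R).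
have lo : 2^-1 - m%:R^-1 @[m --> \oo] --> (2^-1 : R).
  by rewrite -[X in _ --> X]subr0; apply: cvgB => //; exact: cvg_cst.
apply: squeeze_cvgr lo (cvg_cst _); near=> m.
have m0 : 0 < m%:R :> R by rewrite ltr0n; near: m; exact: nbhs_infty_gt.
have E : m%:R = (odd m)%:R + (m./2)%:R * 2 :> R.
  by rewrite -natrM -natrD muln2 odd_double_half.
have o1 : (odd m)%:R <= 1 :> R by case: odd.
have o0 : 0 <= (odd m)%:R :> R by [].
apply/andP; split; last by rewrite ler_pdivrMr//; lra.
by rewrite ler_pdivlMr// mulrBl mulVf ?gt_eqF//; lra.
Unshelve. all: by end_near. Qed.

(* The exponents of the Frechet (s = 1) and Weibull (s = -1) limit laws. *)
Definition rho (R : realType) (s alpha x : R) : R := `|x| `^ (- (s * alpha)).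

(** * Norming constants at the indices m and floor (m/2), for Frechet and Weibull limits *)

Section power_attraction.
Variables (R : realType) (s alpha : R).
Hypotheses (s1 : s = 1 \/ s = -1) (alpha0 : 0 < alpha).
Local Notation rho := (rho s alpha).

Let ss : s * s = 1. Proof. by case: s1 => ->; rewrite ?mulrNN mulr1. Qed.

Let near_side (x : R) : 0 < s * x -> \forall y \near x, 0 < s * y.
Proof.
move=> sx; have c : s * y @[y --> x] --> s * x by apply: cvgM; [exact: cvg_cst|exact: cvg_id].
have /cvgrPdist_lt/(_ _ sx) := c; apply: filterS => y.
by rewrite ltr_norml => /andP[_]; lra.
Qed.

Let normE (x : R) : 0 < s * x -> `|x| = s * x.
Proof.
case: s1 => -> ; rewrite ?mul1r ?mulN1r => h; first by rewrite gtr0_norm.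
by rewrite ltr0_norm -?oppr_gt0.
Qed.

(** On the half-line s x > 0 the exponent is x^(-alpha) for s = 1 and (-x)^alpha for s = -1,
    decreasing in both cases; this lets one argument serve both laws. *)
Lemma rho_decr (x y : R) : 0 < s * x -> 0 < s * y -> x < y -> rho y < rho x.
Proof.
move=> sx sy xy; rewrite /rho !normE//; move: sx sy xy.
case: s1 => ->; rewrite ?mul1r ?mulN1r => x0 y0 xy.
  by rewrite !powRN ltf_pV2 ?posrE ?powR_gt0// gt0_ltr_powR ?nnegrE ?ltW.
by rewrite opprK gt0_ltr_powR ?nnegrE ?(ltW x0) ?(ltW y0)//; lra.
Qed.

Lemma rho_continuous (x : R) : 0 < s * x -> {for x, continuous rho}.
Proof.
move=> sx; apply: (@continuous_comp _ _ _ (fun x : R => `|x|) (fun y => y `^ (- (s * alpha)))).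
  exact: norm_continuous.
by apply: continuous_powRl; rewrite normE.
Qed.

Lemma rho_side : rho s = 1.
Proof. by rewrite /rho normE ?ss// powR1. Qed.

(** Chosen so that rho (q x) = rho x / 2, the effect of halving the index. *)
Let q := 2 `^ (s / alpha).

Let q0 : 0 < q. Proof. exact: powR_gt0. Qed.

Lemma rho_scale (x : R) : 0 < s * x -> rho (q * x) = 2^-1 * rho x.
Proof.
move=> sx; rewrite /rho normrM (gtr0_norm q0) powRM ?(ltW q0)//; congr (_ * _).
rewrite -powRrM (_ : _ * - (s * alpha) = -1) ?powR_inv1//.
by rewrite mulrN mulrACA mulVf ?gt_eqF// mulr1 ss.
Qed.

Variables (F : R -> R) (a b : nat -> R).
Hypotheses (F_homo : {homo F : x y / x <= y})
  (a_gt0 : forall n, 0 < a n)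
  (F_attr : forall x, 0 < s * x ->
     n%:R * (1 - F (a n * x + b n)) @[n --> \oo] --> rho x).

Let N_anti (M : R) : 0 <= M -> {homo (fun x => M * (1 - F x)) : x y /~ x <= y}.
Proof. by move=> M0 x y xy; rewrite ler_wpM2l// lerD2l lerN2 F_homo. Qed.

Let near_decr (x : R) : 0 < s * x ->
  \forall y \near x, (y < x -> rho x < rho y) /\ (x < y -> rho y < rho x).
Proof. by move=> sx; apply: filterS (near_side sx) => y sy; split; exact: rho_decr. Qed.

(** With the factor floor (m/2) instead of m, the tail at a_m x + b_m tends to rho x / 2 = rho (q
    x), so this point has limiting coordinate q x at the index floor (m/2). *)
Let halving_pt (x : R) : 0 < s * x ->
  (a m * x + b m - b m./2) / a m./2 @[m --> \oo] --> q * x.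
Proof.
move=> sx; have sqx : 0 < s * (q * x) by rewrite mulrCA mulr_gt0.
apply: (@norming_cvg_inv _ _ _ _ (fun m x => (m./2)%:R * (1 - F x)) _ _ rho).
- by move=> m; exact: N_anti.
- exact: nearW.
- apply: filterS (near_side sqx) => y sy.
  exact: (@cvg_comp _ _ _ (fun m => m./2) _ _ _ _ cvg_half (F_attr sy)).
- exact: near_decr.
- rewrite rho_scale//.
  have : (m./2)%:R / m%:R * (m%:R * (1 - F (a m * x + b m))) @[m --> \oo] --> 2^-1 * rho x.
    by apply: cvgM; [exact: cvg_half_ratio|exact: F_attr].
  apply: cvg_trans; apply: near_eq_cvg; near=> m.
  have m0 : m%:R != 0 :> R by rewrite pnatr_eq0 -lt0n; near: m; exact: nbhs_infty_gt.
  by field.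
Unshelve. all: by end_near. Qed.

(** The change of coordinates from index m to floor (m/2) is affine and tends to x -> q x. Its
    values at s and 2 s determine the slope ([E1], using s s = 1) and the offset ([E2]). *)
Lemma norming_halving :
  a m / a m./2 @[m --> \oo] --> q /\ (b m - b m./2) / a m./2 @[m --> \oo] --> (0 : R).
Proof.
have h1 : 0 < s * s by rewrite ss.
have h2 : 0 < s * (2 * s) by rewrite mulrCA ss.
have c1 := halving_pt h1; have c2 := halving_pt h2.
have E1 : s * ((a m * (2 * s) + b m - b m./2) / a m./2 - (a m * s + b m - b m./2) / a m./2)
    @[m --> \oo] --> s * (q * (2 * s) - q * s).
  by apply: cvgM; [exact: cvg_cst|exact: cvgB].
have E2 : 2 * ((a m * s + b m - b m./2) / a m./2) - ((a m * (2 * s) + b m - b m./2) / a m./2)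
    @[m --> \oo] --> 2 * (q * s) - q * (2 * s).
  by apply: cvgB => //; apply: cvgM => //; exact: cvg_cst.
split.
  move: E1; rewrite (_ : s * (q * (2 * s) - q * s) = q * (s * s)); last by ring.
  rewrite ss mulr1.
  apply: cvg_trans; apply: near_eq_cvg; near=> m.
  rewrite -mulrBl (_ : a m * (2 * s) + _ - _ - _ = a m * s); last by ring.
  by rewrite mulrA mulrCA ss mulr1.
move: E2; rewrite (_ : _ - q * (2 * s) = 0); last by ring.
apply: cvg_trans; apply: near_eq_cvg; near=> m.
by rewrite mulrA -mulrBl; congr (_ / _); ring.
Unshelve. all: by end_near. Qed.

(** At the index n_i = floor (1 / (1 - F c_i)), the point c_i has limiting coordinate s, because rho
    s = 1, and beta has coordinate 0. Hence s (c_i - beta) x + beta has coordinate s s x = x. *)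
Lemma attraction_ratio (beta : R) (I : Type) (H : set_system I) {FH : Filter H}
    (c : I -> R) (x : R) :
  (beta - b n) / a n @[n --> \oo] --> (0 : R) ->
  (\forall i \near H, F (c i) < 1) -> F (c i) @[i --> H] --> (1 : R) -> 0 < s * x ->
  (1 - F (s * (c i - beta) * x + beta)) / (1 - F (c i)) @[i --> H] --> rho x.
Proof.
move=> betab c1 Fc sx; pose p i := 1 - F (c i).
have p_gt0 : \forall i \near H, 0 < p i by apply: filterS c1 => i; rewrite subr_gt0.
have p0 : p i @[i --> H] --> (0 : R).
  by rewrite -(subrr 1); apply: cvgB => //; exact: cvg_cst.
have [] := truncn_inv_cvg p_gt0 p0; set n := fun i => Num.truncn (p i)^-1 => noo np.
have cN y : 0 < s * y -> (n i)%:R * (1 - F (a (n i) * y + b (n i))) @[i --> H] --> rho y.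
  by move=> sy; exact: (@cvg_comp _ _ _ n _ _ _ _ noo (F_attr sy)).
have h1 : 0 < s * s by rewrite ss.
have cs : (c i - b (n i)) / a (n i) @[i --> H] --> s.
  apply: (@norming_cvg_inv _ _ _ _ (fun i x => (n i)%:R * (1 - F x)) _ _ rho).
  - by move=> i; exact: N_anti.
  - exact: nearW.
  - by apply: filterS (near_side h1) => y; exact: cN.
  - exact: near_decr.
  - by rewrite rho_side.
have cb : (beta - b (n i)) / a (n i) @[i --> H] --> (0 : R).
  exact: (@cvg_comp _ _ _ n _ _ _ _ noo betab).
have cz : (s * (c i - beta) * x + beta - b (n i)) / a (n i) @[i --> H] --> x.
  have : (beta - b (n i)) / a (n i) +
    s * x * ((c i - b (n i)) / a (n i) - (beta - b (n i)) / a (n i))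
     @[i --> H] --> 0 + s * x * (s - 0).
    by apply: cvgD => //; apply: cvgM; [exact: cvg_cst|exact: cvgB].
  rewrite add0r subr0 mulrAC ss mul1r; apply: cvg_trans; apply: near_eq_cvg; apply: nearW => i.
  by field; rewrite gt_eqF.
apply: (@cvg_ratio _ _ _ _ (fun i => (n i)%:R)) => //.
apply: (@norming_cvg _ _ _ _ (fun i x => (n i)%:R * (1 - F x)) _ _ rho x _ _ _ _ _ cz).
- by move=> i; exact: N_anti.
- exact: nearW.
- by apply: filterS (near_side sx) => y; exact: cN.
- exact: rho_continuous.
Qed.

End power_attraction.

(** * Domains of attraction *)

Section frechet.
Variables (R : realType) (alpha : R) (F : R -> R) (a b : nat -> R).
Hypotheses (alpha0 : 0 < alpha) (F_homo : {homo F : x y / x <= y})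
  (a_gt0 : forall n, 0 < a n)
  (F_attr : forall x, 0 < 1 * x ->
     n%:R * (1 - F (a n * x + b n)) @[n --> \oo] --> rho 1 alpha x).

(** Here q > 1, and u_m = |beta - b_m| / a_m satisfies u_m <= (u_h + e) a_h / a_m with h = floor
    (m/2), where a_h / a_m tends to 1/q < 1. This is the halving contraction. *)
Lemma frechet_norming (beta : R) : (beta - b n) / a n @[n --> \oo] --> (0 : R).
Proof.
have [aq bq] := norming_halving (or_introl (erefl 1)) alpha0 F_homo a_gt0 F_attr.
set q := 2 `^ (1 / alpha) in aq.
have q1 : 1 < q.
  have l2 : 0 < ln 2 :> R by rewrite ln_gt0//; lra.
  by rewrite /q /powR pnatr_eq0/= -[ltLHS]expR0 ltr_expR mulr_gt0// divr_gt0.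
have q0 : 0 < q by lra.
pose t := (q^-1 + 1) / 2.
have qi : q^-1 < 1 by rewrite invf_lt1.
have qi0 : 0 < q^-1 by rewrite invr_gt0.
have t01 : 0 <= t < 1 by rewrite /t; apply/andP; split; lra.
have aq' : a m./2 / a m @[m --> \oo] --> q^-1.
  have : (a m / a m./2)^-1 @[m --> \oo] --> q^-1 by apply: cvgV => //; rewrite gt_eqF.
  apply: cvg_trans; apply: near_eq_cvg; apply: nearW => m.
  by rewrite invf_div.
have : `|beta - b n| / a n @[n --> \oo] --> (0 : R).
  apply: (halving_contraction_cvg0 t01) => [n|e e0]; first by rewrite divr_ge0// ltW.
  near=> m.
  have h1 : a m./2 / a m <= t.
    have : `|q^-1 - a m./2 / a m| < t - q^-1.
      by near: m; move/cvgrPdist_lt : aq'; apply; rewrite /t; lra.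
    by rewrite ltr_norml => /andP[]; lra.
  have h2 : `|b m - b m./2| / a m./2 <= e.
    have : `|0 - (b m - b m./2) / a m./2| < e.
      by near: m; move/cvgrPdist_lt : bq; exact.
    by rewrite sub0r normrN normrM normfV (gtr0_norm (a_gt0 _)) => /ltW.
  have am := a_gt0 m; have ah := a_gt0 m./2.
  have h3 : `|beta - b m| / a m <=
      (`|beta - b m./2| / a m./2 + `|b m - b m./2| / a m./2) * (a m./2 / a m).
    rewrite -mulrDl mulrA divfK ?gt_eqF// ler_pM2r ?invr_gt0//.
    by rewrite (_ : beta - b m = beta - b m./2 - (b m - b m./2)) ?ler_normB//; ring.
  have h4 : 0 <= `|beta - b m./2| / a m./2 by rewrite divr_ge0// ltW.
  have h5 : 0 <= `|b m - b m./2| / a m./2 by rewrite divr_ge0// ltW.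
  have h6 : 0 < a m./2 / a m by rewrite divr_gt0.
  have /andP[? ?] := t01; apply: le_trans h3 _; nra.
move=> h; apply/norm_cvg0P; apply: cvg_trans h; apply: near_eq_cvg; apply: nearW => n.
by rewrite normrM normfV (gtr0_norm (a_gt0 n)).
Unshelve. all: by end_near. Qed.

(** Every x is eventually below a_n + b_n, where n (1 - F) has a positive limit and therefore F <
    1. *)
Lemma frechet_lt1 (x : R) : F x < 1.
Proof.
have h1 : (0 : R) < 1 * 1 by rewrite mulr1.
have : \forall n \near \oo, F x < 1.
  near=> n.
  have h2 : F (a n * 1 + b n) < 1.
    have : `|rho 1 alpha 1 - n%:R * (1 - F (a n * 1 + b n))| < rho 1 alpha 1.
      near: n; move/cvgrPdist_lt : (F_attr h1); apply.
      by rewrite /rho powR_gt0// normr_gt0 oner_eq0.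
    rewrite ltr_norml => /andP[_ h]; have : 0 < n%:R * (1 - F (a n * 1 + b n)) by lra.
    have n0 : 0 <= n%:R :> R by rewrite ler0n.
    by rewrite !ltNge; apply: contra => ?; rewrite mulr_ge0_le0//; lra.
  have h3 : (x - b n) / a n < 1.
    have : `|0 - (x - b n) / a n| < 1.
      by near: n; move/cvgrPdist_lt : (frechet_norming x); exact.
    by rewrite sub0r normrN => /ltr_normlW.
  apply: le_lt_trans h2; apply: F_homo.
  by move: h3; rewrite ltr_pdivrMr// mul1r mulr1; lra.
by case/filter_ex.
Unshelve. all: by end_near. Qed.

End frechet.

Section weibull.
Variables (R : realType) (alpha : R) (F : R -> R) (a b : nat -> R).
Hypotheses (alpha0 : 0 < alpha) (dF : is_df F) (cF : continuous F)
  (a_gt0 : forall n, 0 < a n)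
  (F_attr : forall x, 0 < -1 * x ->
     n%:R * (1 - F (a n * x + b n)) @[n --> \oo] --> rho (-1) alpha x)
  (F_attr0 : forall x, 0 < x ->
     n%:R * (1 - F (a n * x + b n)) @[n --> \oo] --> (0 : R)).

Let F_homo : {homo F : x y / x <= y}. Proof. by case: dF. Qed.

(* Along n -> 2n the points b n + delta a n decrease, and they eventually exceed
   every t with F t < 1. *)
Lemma weibull_upper (d : R) : 0 < d ->
  \forall n \near \oo, forall t, F t < 1 -> t < b n + d * a n.
Proof.
move=> d0.
have [aq bq] := norming_halving (or_intror (erefl (-1))) alpha0 F_homo a_gt0 F_attr.
set q := 2 `^ (-1 / alpha) in aq.
have q0 : 0 < q by exact: powR_gt0.
have q1 : q < 1.
  have l2 : 0 < ln 2 :> R by rewrite ln_gt0//; lra.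
  by rewrite /q /powR pnatr_eq0/= -[ltRHS]expR0 ltr_expR mulN1r mulNr oppr_lt0 mulr_gt0 ?invr_gt0.
have e0 : 0 < d * (1 - q) / 2 by rewrite divr_gt0// mulr_gt0// subr_gt0.
have [n0 _ Hn0] : \forall m \near \oo, b m + d * a m <= b m./2 + d * a m./2.
  near=> m.
  (* The shares d (1 + q) / 2 from the slope and d (1 - q) / 2 from the offset add up to d. *)
  have h1 : a m / a m./2 < (1 + q) / 2.
    have : `|q - a m / a m./2| < (1 - q) / 2.
      by near: m; move/cvgrPdist_lt : aq; apply; lra.
    by rewrite ltr_norml => /andP[]; lra.
  have h2 : (b m - b m./2) / a m./2 < d * (1 - q) / 2.
    have : `|0 - (b m - b m./2) / a m./2| < d * (1 - q) / 2.
      by near: m; move/cvgrPdist_lt : bq; exact.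
    by rewrite sub0r normrN => /ltr_normlW.
  move: h1 h2; rewrite !ltr_pdivrMr// => h1 h2.
  have ah := a_gt0 m./2; nra.
(* The successor makes n positive, so that 2^j n is unbounded in j. *)
exists n0.+1 => //= n n0n t Ft.
have dn j : b (2 ^ j * n)%N + d * a (2 ^ j * n)%N <= b n + d * a n.
  elim: j => [|j IH]; first by rewrite expn0 mul1n.
  apply: le_trans IH; have := Hn0 (2 ^ j.+1 * n)%N.
  rewrite expnS -mulnA mul2n doubleK; apply => /=.
  rewrite -mul2n mulnA -expnS (leq_trans (ltnW n0n))// leq_pmull// expn_gt0//.
(* At b_m + d a_m even m (1 - F) tends to 0, so 1 - F is eventually smaller there than the positive
   number 1 - F t. *)
have : \forall m \near \oo, t < b m + d * a m.
  have Ft0 : 0 < 1 - F t by rewrite subr_gt0.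
  near=> m.
  have m1 : 1 <= m%:R :> R by rewrite ler1n; near: m; exact: nbhs_infty_gt.
  have : `|0 - m%:R * (1 - F (a m * d + b m))| < 1 - F t.
    by near: m; move/cvgrPdist_lt : (F_attr0 d0); exact.
  rewrite sub0r normrN => /ltr_normlW h.
  rewrite addrC mulrC ltNge; apply/negP => /F_homo h'.
  nra.
move=> [m0 _ Hm0]; apply: lt_le_trans (dn m0); apply: Hm0 => /=.
by rewrite (leq_trans (ltnW (ltn_expl m0 (ltnSn 1))))// leq_pmulr// (leq_trans _ n0n).
Unshelve. all: by end_near. Qed.

(** An infinite right end would contradict [weibull_upper] at t = b_n + a_n. A finite r is at most
    b_n + e a_n by that lemma, and exceeds b_n - e a_n because n (1 - F) has a positive limit
    there. *)
Lemma weibull_right_end : exists r, [/\ right_extremity F = r%:E, F r = 1,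
  forall x, (F x < 1) = (x < r) &  (r - b n) / a n @[n --> \oo] --> (0 : R)].
Proof.
have [[_ lt1]|[r [re Fr lt1]]] := right_extremity_cases dF cF.
  have [n _ /(_ n (leqnn n)) h] := weibull_upper ltr01.
  by have := h _ (lt1 (b n + 1 * a n)); rewrite ltxx.
exists r; split => //; apply/cvgrPdist_le => e e0; have e1 : 0 < -1 * - e by rewrite mulrNN mul1r.
near=> n.
have an := a_gt0 n.
have h1 : r <= b n + e * a n.
  rewrite leNgt -lt1; apply/negP => h.
  have : forall t, F t < 1 -> t < b n + e * a n by near: n; exact: weibull_upper.
  by move=> /(_ _ h); rewrite ltxx.
have h2 : b n - e * a n < r.
  have : `|rho (-1) alpha (- e) - n%:R * (1 - F (a n * - e + b n))| < rho (-1) alpha (- e).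
    near: n; move/cvgrPdist_lt : (F_attr e1); apply.
    by rewrite /rho powR_gt0// normr_gt0 oppr_eq0 gt_eqF.
  rewrite ltr_norml => /andP[_ h]; have : 0 < n%:R * (1 - F (a n * - e + b n)) by lra.
  have n0 : 0 <= n%:R :> R by rewrite ler0n.
  rewrite -lt1 (_ : b n - e * a n = a n * - e + b n); last by ring.
  by rewrite !ltNge; apply: contra => ?; rewrite mulr_ge0_le0//; lra.
rewrite sub0r normrN normrM normfV (gtr0_norm an) ler_pdivrMr// ler_norml.
by apply/andP; split; lra.
Unshelve. all: by end_near. Qed.

End weibull.

(** At the index n_i = floor (1 / (1 - F c_i)), c_i has limiting coordinate 0 and the hypothesis on
    the ratio gives c_i + v_i coordinate 1. So c_i + v_i x has coordinate x, also for negative x. *)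
Lemma gumbel_ratio (R : realType) (F : R -> R) (a b : nat -> R)
    (I : Type) (H : set_system I) {FH : Filter H} (c v : I -> R) (x : R) :
  {homo F : x y / x <= y} -> (forall n, 0 < a n) ->
  (forall x, n%:R * (1 - F (a n * x + b n)) @[n --> \oo] --> expR (- x)) ->
  (\forall i \near H, F (c i) < 1) -> F (c i) @[i --> H] --> (1 : R) ->
  (1 - F (c i + v i)) / (1 - F (c i)) @[i --> H] --> expR (- 1) ->
  (1 - F (c i + v i * x)) / (1 - F (c i)) @[i --> H] --> expR (- x).
Proof.
move=> F_homo a_gt0 F_attr c1 Fc Fv; pose p i := 1 - F (c i).
have p_gt0 : \forall i \near H, 0 < p i by apply: filterS c1 => i; rewrite subr_gt0.
have p0 : p i @[i --> H] --> (0 : R).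
  by rewrite -(subrr 1); apply: cvgB => //; exact: cvg_cst.
have [] := truncn_inv_cvg p_gt0 p0; set n := fun i => Num.truncn (p i)^-1 => noo np.
pose e x : R := expR (- x).
have cN y : (n i)%:R * (1 - F (a (n i) * y + b (n i))) @[i --> H] --> e y.
  exact: (@cvg_comp _ _ _ n _ _ _ _ noo (F_attr y)).
have ce y : {for y, continuous e}.
  apply: (@continuous_comp _ _ _ (fun y : R => - y) (@expR R)); last exact: continuous_expR.
  exact: opp_continuous.
have N_anti i : {homo (fun x => (n i)%:R * (1 - F x)) : x y /~ x <= y}.
  by move=> y z yz; rewrite ler_wpM2l ?ler0n// lerD2l lerN2 F_homo.
have decr (y : R) : \forall z \near y, (z < y -> e y < e z) /\ (y < z -> e z < e y).
  by apply: filterE => z; rewrite /e !ltr_expR !ltrN2.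
have inv (y : R) (z : I -> R) : (n i)%:R * (1 - F (z i)) @[i --> H] --> e y ->
    (z i - b (n i)) / a (n i) @[i --> H] --> y.
  apply: (@norming_cvg_inv _ _ _ _ (fun i x => (n i)%:R * (1 - F x))) => //.
  - exact: nearW.
  - by apply: filterE => u; exact: cN.
have c0 : (c i - b (n i)) / a (n i) @[i --> H] --> (0 : R).
  by apply: inv; rewrite /e oppr0 expR0.
have cv : (c i + v i - b (n i)) / a (n i) @[i --> H] --> (1 : R).
  by apply: inv; exact: cvg_ratio_inv Fv np.
apply: (@cvg_ratio _ _ _ _ (fun i => (n i)%:R)) => //.
apply: (@norming_cvg _ _ _ _ (fun i x => (n i)%:R * (1 - F x)) (a \o n) (b \o n) e x) => //=.
- exact: nearW.
- by apply: filterE => u; exact: cN.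
have : (c i - b (n i)) / a (n i) + ((c i + v i - b (n i)) / a (n i) - (c i - b (n i)) / a (n i)) * x
   @[i --> H] --> 0 + (1 - 0) * x.
  by apply: cvgD => //; apply: cvgM; [exact: cvgB|exact: cvg_cst].
rewrite add0r subr0 mul1r; apply: cvg_trans; apply: near_eq_cvg; apply: nearW => i.
by field; rewrite gt_eqF.
Qed.

(** * Quantiles of continuous distribution functions *)

Lemma quantileK (R : realType) (F : R -> R) (y : R) :
  is_df F -> continuous F -> 0 < y < 1 -> F (quantile F y) = y.
Proof.
move=> [homoF _ F0 F1] cF /andP[y0 y1].
have [x1 Fx1] : exists x, y < F x.
  have : \forall z \near +oo, y < F z.
    have /cvgrPdist_lt/(_ (1 - y)) := F1; rewrite subr_gt0 => /(_ y1).
    by apply: filterS => z; rewrite ltr_norml => /andP[_]; lra.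
  by case/filter_ex => z ?; exists z.
have [x0 Fx0] : exists x, F x < y.
  have : \forall z \near -oo, F z < y.
    have /cvgrPdist_lt/(_ y y0) := F0.
    by apply: filterS => z; rewrite sub0r normrN; exact: le_lt_trans (ler_norm _).
  by case/filter_ex => z ?; exists z.
have x01 : x0 <= x1 by apply: ltW; rewrite ltNge; apply/negP => /homoF; lra.
have [|x _ Fx] := @IVT _ F x0 x1 y x01 (continuous_subspaceT cF).
  by rewrite ge_min (ltW Fx0)/= le_max (ltW Fx1) orbT.
rewrite /quantile; set S := [set x | _].
have lS : has_inf S.
  split; first by exists x; rewrite /S/= Fx.
  exists x0 => z; rewrite /S/= => yz; rewrite leNgt; apply/negP => /ltW/homoF; lra.
apply/eqP; rewrite eq_le; apply/andP; split.
  by rewrite -[leRHS]Fx; apply: homoF; apply: ge_inf; [case: lS|rewrite /S/= Fx].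
rewrite leNgt; apply/negP => Fm.
have : \forall z \near inf S, F z < y.
  have /cvgrPdist_lt/(_ (y - F (inf S))) : F z @[z --> inf S] --> F (inf S) by exact: cF.
  rewrite subr_gt0 => /(_ Fm); apply: filterS => z; rewrite distrC ltr_norml => /andP[_]; lra.
move=> /nbhs_ballP[e /= e0 He].
have [z Sz zm] := inf_adherent e0 lS.
have mz : inf S <= z by apply: ge_inf => //; case: lS.
have := He z; rewrite /ball/= distrC ger0_norm ?subr_ge0// ltrBlDl => /(_ zm).
by move: Sz; rewrite /S/=; lra.
Qed.

Lemma quantile_n (R : realType) (G : R -> R) : is_df G -> continuous G ->
  \forall n \near \oo, G (quantile G (1 - 1 / n%:R)) = 1 - 1 / n%:R.
Proof.
move=> dG cG; near=> n; apply: quantileK => //.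
have n1 : 1 < n%:R :> R by rewrite ltr1n; near: n; exact: nbhs_infty_gt.
have n0 : 0 < n%:R :> R by lra.
have i0 : 0 < 1 / n%:R :> R by rewrite divr_gt0.
have i1 : 1 / n%:R < 1 :> R by rewrite ltr_pdivrMr// mul1r.
by apply/andP; split; lra.
Unshelve. all: by end_near. Qed.

Lemma quantile_n_lt1 (R : realType) (G : R -> R) : is_df G -> continuous G ->
  \forall n \near \oo, G (quantile G (1 - 1 / n%:R)) < 1.
Proof.
move=> dG cG; near=> n; have -> : G (quantile G (1 - 1 / n%:R)) = 1 - 1 / n%:R.
  by near: n; exact: quantile_n.
by rewrite gtrBl divr_gt0// ltr0n; near: n; exact: nbhs_infty_gt.
Unshelve. all: by end_near. Qed.

Lemma quantile_n_tail (R : realType) (G : R -> R) : is_df G -> continuous G ->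
  n%:R * (1 - G (quantile G (1 - 1 / n%:R))) @[n --> \oo] --> (1 : R).
Proof.
move=> dG cG; have : (1 : R) @[n --> \oo] --> (1 : R) by exact: cvg_cst.
apply: cvg_trans; apply: near_eq_cvg; near=> n.
have -> : G (quantile G (1 - 1 / n%:R)) = 1 - 1 / n%:R by near: n; exact: quantile_n.
have n0 : n%:R != 0 :> R by rewrite pnatr_eq0 -lt0n; near: n; exact: nbhs_infty_gt.
by field.
Unshelve. all: by end_near. Qed.

Lemma quantile_n_cvg1 (R : realType) (G : R -> R) : is_df G -> continuous G ->
  G (quantile G (1 - 1 / n%:R)) @[n --> \oo] --> (1 : R).
Proof.
move=> dG cG; have : 1 - n%:R^-1 @[n --> \oo] --> (1 : R).
  rewrite -[X in _ --> X]subr0; apply: cvgB; first exact: cvg_cst.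
  by rewrite -(@cvg_shiftS R^o (fun n => n%:R^-1)); exact: (@cvg_harmonic R).
apply: cvg_trans; apply: near_eq_cvg; apply: filterS (quantile_n dG cG) => n ->.
by rewrite mul1r.
Qed.

(** [Dl] asks for a_n > 0 at every n, while quantile norming is shown positive only eventually; the
    remaining finitely many terms are replaced by 1. *)
Lemma Dl_eventually (R : realType) (F G : R -> R) (a b : nat -> R) :
  (\forall n \near \oo, 0 < a n) ->
  (forall x, F (a n * x + b n) ^+ n @[n --> \oo] --> G x) -> Dl F G.
Proof.
move=> a_gt0 FG; exists (fun n => if 0 < a n then a n else 1), b; split.
  by move=> n; case: ifP.
move=> x _; apply: cvg_trans (FG x); apply: near_eq_cvg.
by apply: filterS a_gt0 => n ->.
Qed.

Lemma Dl_exponent (R : realType) (F G : R -> R) (a b : nat -> R) (x l : R) :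
  is_df F -> (forall x, {for x, continuous G} ->
    F (a n * x + b n) ^+ n @[n --> \oo] --> G x) ->
  {for x, continuous G} -> G x = expR (- l) -> (forall x, 0 <= F x) ->
  n%:R * (1 - F (a n * x + b n)) @[n --> \oo] --> l.
Proof.
move=> dF FG cG Gx F0; apply: (@cvg_pow_expR_inv _ (fun n => F (a n * x + b n))).
  by move=> n; rewrite F0 df_le1.
by rewrite -Gx; exact: FG.
Qed.

Lemma Phi_continuous (R : realType) (alpha x : R) : 0 < x -> {for x, continuous (Phi alpha)}.
Proof.
move=> x0; rewrite /prop_for /continuous_at {2}/Phi x0.
have : expR (- (y `^ (- alpha))) @[y --> x] --> expR (- (x `^ (- alpha))).
  apply: continuous_cvg; first exact: continuous_expR.
  by apply: cvgN; exact: continuous_powRl.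
apply: cvg_trans; apply: near_eq_cvg; near=> y.
by rewrite /Phi ifT//; near: y; exact: lt_nbhsr.
Unshelve. all: by end_near. Qed.

Lemma Psi_continuous (R : realType) (alpha x : R) : x != 0 -> {for x, continuous (Psi alpha)}.
Proof.
move=> x0; rewrite /prop_for /continuous_at; have [xn|xp] := ltP x 0.
  rewrite {2}/Psi xn.
  have : expR (- (`|y| `^ alpha)) @[y --> x] --> expR (- (`|x| `^ alpha)).
    apply: continuous_cvg; first exact: continuous_expR.
    apply: cvgN; apply: (@cvg_comp _ _ _ (fun y : R => `|y|) (fun y => y `^ alpha) _ (nbhs `|x|)).
      by apply: cvg_norm; exact: cvg_id.
    by apply: continuous_powRl; rewrite normr_gt0.
  apply: cvg_trans; apply: near_eq_cvg; near=> y.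
  by rewrite /Psi ifT//; near: y; exact: lt_nbhsl.
have xp' : 0 < x by rewrite lt_def x0.
have -> : Psi alpha x = 1 by rewrite /Psi ltNge xp.
have : (1 : R) @[y --> x] --> (1 : R) by exact: cvg_cst.
apply: cvg_trans; apply: near_eq_cvg; near=> y.
by rewrite /Psi ifF//; apply/negbTE; rewrite -leNgt ltW//; near: y; exact: lt_nbhsr.
Unshelve. all: by end_near. Qed.

Lemma Lambda_continuous (R : realType) (x : R) : {for x, continuous (@Lambda R)}.
Proof.
have : expR (- expR (- y)) @[y --> x] --> expR (- expR (- x)).
  apply: continuous_cvg; first exact: continuous_expR.
  apply: cvgN; apply: continuous_cvg; first exact: continuous_expR.
  exact: opp_continuous.
by [].
Qed.

(** * Norming sequences for T_k *)

Section Tk_attraction.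
Variables (R : realType) (F f : R -> R) (r : R) (k : nat).
Hypotheses (dF : is_df F) (pF : is_pdf F f) (r0 : 0 < r) (k0 : (0 < k)%N).
Let T := Tk r k F.
Let C := nbcoef r k.
Let cF := df_continuous dF pF.
Let F_homo : {homo F : x y / x <= y}. Proof. by case: dF. Qed.
Let F_ge0 := df_ge0 pF.
Let dT := Tk_is_df dF pF r0 k0.
Let cT : continuous T. Proof. exact: Tk_continuous pF r0. Qed.
Let T_lt1 x : (T x < 1) = (F x < 1). Proof. exact: Tk_lt1. Qed.
Let C0 : 0 < C. Proof. exact: nbcoef_gt0. Qed.

Section power_norming.
Variables (K : R).
Hypothesis K0 : 0 < K.
(** The two values of interest are K = 1 and K = k B(r, k); for the latter K C = 1. *)
Let p n : R := (K / n%:R) `^ (1 / k%:R).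
Let c n := quantile F (1 - p n).

Let pX n : p n ^+ k = K / n%:R.
Proof.
have h : 0 <= K / n%:R by rewrite divr_ge0 ?ler0n// ltW.
rewrite /p -powR_mulrn ?powR_ge0// -powRrM mul1r mulVf ?powRr1//.
by rewrite pnatr_eq0 -lt0n.
Qed.

Let p_gt0 : \forall n \near \oo, 0 < p n.
Proof.
near=> n; have n0 : 0 < n%:R :> R by rewrite ltr0n; near: n; exact: nbhs_infty_gt.
by rewrite powR_gt0// divr_gt0.
Unshelve. all: by end_near. Qed.

Let p_cvg0 : p n @[n --> \oo] --> (0 : R).
Proof.
have Kn : K * n%:R^-1 @[n --> \oo] --> (0 : R).
  rewrite -[X in _ --> X](mulr0 K); apply: cvgM; first exact: cvg_cst.
  by rewrite -(@cvg_shiftS R^o (fun n => n%:R^-1)); exact: (@cvg_harmonic R).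
apply/cvgrPdist_lt => e e0; near=> n.
rewrite sub0r normrN ger0_norm ?powR_ge0//.
have : p n ^+ k < e ^+ k.
  rewrite pX; have : `|0 - K * n%:R^-1| < e ^+ k.
    by near: n; move/cvgrPdist_lt : Kn; apply; rewrite exprn_gt0.
  by rewrite sub0r normrN; exact: le_lt_trans (ler_norm _).
by rewrite !ltNge; apply: contra => ep; apply: lerXn2r; rewrite ?nnegrE ?powR_ge0 ?(ltW e0).
Unshelve. all: by end_near. Qed.

Let F_c : \forall n \near \oo, F (c n) = 1 - p n.
Proof.
near=> n; apply: quantileK => //.
have pn : 0 < p n by near: n.
have : `|0 - p n| < 1 by near: n; move/cvgrPdist_lt : p_cvg0; exact.
by rewrite sub0r normrN => /ltr_normlW ?; apply/andP; split; lra.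
Unshelve. all: by end_near. Qed.

Lemma power_norming_lt1 : \forall n \near \oo, F (c n) < 1.
Proof. by apply: filterS2 p_gt0 F_c => n pn ->; rewrite gtrBl. Qed.

Lemma power_norming_cvg1 : F (c n) @[n --> \oo] --> (1 : R).
Proof.
have : 1 - p n @[n --> \oo] --> (1 : R).
  by rewrite -[X in _ --> X]subr0; apply: cvgB => //; exact: cvg_cst.
by apply: cvg_trans; apply: near_eq_cvg; apply: filterS F_c => n ->.
Qed.

(** The tail of F at c_n is p_n, so M = 1 / p_n normalizes it, and M^k = n / K is the norming of the
    tail of T_k up to the factor K. *)
Lemma Tk_power_norming (z : nat -> R) (l : R) :
  (1 - F (z n)) / (1 - F (c n)) @[n --> \oo] --> l ->
  T (z n) ^+ n @[n --> \oo] --> expR (- (K * C * l ^+ k)).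
Proof.
move=> zl; apply: cvg_pow_expR => [n|]; first exact: df_le1.
have Mc : (p n)^-1 * (1 - F (c n)) @[n --> \oo] --> (1 : R).
  have : (1 : R) @[n --> \oo] --> (1 : R) by exact: cvg_cst.
  apply: cvg_trans; apply: near_eq_cvg; apply: filterS2 p_gt0 F_c => n pn ->.
  by rewrite subKr mulVf ?gt_eqF.
have Mz : (p n)^-1 * (1 - F (z n)) @[n --> \oo] --> l by exact: cvg_ratio_inv zl Mc.
have Fz : F (z n) @[n --> \oo] --> (1 : R).
  have : 1 - (p n)^-1 * (1 - F (z n)) * p n @[n --> \oo] --> 1 - l * 0.
    by apply: cvgB; [exact: cvg_cst|apply: cvgM => //; exact: p_cvg0].
  rewrite mulr0 subr0; apply: cvg_trans; apply: near_eq_cvg; apply: filterS p_gt0 => n pn.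
  by field; rewrite gt_eqF.
have Tz : (p n)^-1 ^+ k * (1 - T (z n)) @[n --> \oo] --> C * l ^+ k.
  exact: Tk_tail_transfer.
have : K * ((p n)^-1 ^+ k * (1 - T (z n))) @[n --> \oo] --> K * (C * l ^+ k).
  by apply: cvgM => //; exact: cvg_cst.
rewrite mulrA; apply: cvg_trans; apply: near_eq_cvg; near=> n.
have n0 : n%:R != 0 :> R by rewrite pnatr_eq0 -lt0n; near: n; exact: nbhs_infty_gt.
by rewrite exprVn pX; field; rewrite n0 gt_eqF.
Unshelve. all: by end_near. Qed.

Variables (a b : nat -> R) (alpha : R).
Hypotheses (alpha0 : 0 < alpha) (a_gt0 : forall n, 0 < a n).

Lemma Tk_frechet : (forall x, 0 < 1 * x ->
     n%:R * (1 - F (a n * x + b n)) @[n --> \oo] --> rho 1 alpha x) ->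
  (\forall n \near \oo, 0 < c n) /\
  forall x, T (c n * x + 0) ^+ n @[n --> \oo] --> Phi (k%:R * alpha) x `^ (K * C).
Proof.
move=> F_attr.
have c_gt0 : \forall n \near \oo, 0 < c n.
  have : c n @[n --> \oo] --> left_filter (right_extremity F).
    by apply: (cvg_left_filter dF cF); [exact: power_norming_lt1|exact: power_norming_cvg1].
  case: (right_extremity_cases dF cF) => [[-> _]|[x [_ Fx _]]]; last first.
    by have := frechet_lt1 alpha0 F_homo a_gt0 F_attr x; rewrite Fx ltxx.
  by move=> /cvgryPgt; exact.
split => // x.
have KC0 : 0 < K * C by rewrite mulr_gt0.
have pos y : 0 < y ->
    T (c n * y + 0) ^+ n @[n --> \oo] --> expR (- (K * C * y `^ (- (k%:R * alpha)))).
  move=> y0; have h : 0 < 1 * y by rewrite mul1r.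
  rewrite (_ : y `^ _ = rho 1 alpha y ^+ k); last first.
    rewrite /rho gtr0_norm// mul1r -powR_mulrn ?powR_ge0// -powRrM; congr (_ `^ _); ring.
  apply: Tk_power_norming.
  apply: cvg_trans (attraction_ratio (or_introl (erefl 1)) alpha0 F_homo a_gt0 F_attr
    (frechet_norming alpha0 F_homo a_gt0 F_attr 0) power_norming_lt1 power_norming_cvg1 h).
  by apply: near_eq_cvg; apply: nearW => n; rewrite mul1r subr0.
rewrite /Phi; case: ifPn => [x0|]; first by rewrite -expRM mulNr mulrC; exact: pos.
rewrite -leNgt => x0; rewrite powR0 ?gt_eqF//.
apply/cvgrPdist_lt => e e0.
have ka0 : 0 < k%:R * alpha by rewrite mulr_gt0// ltr0n.
(* For x <= 0 the power is bounded by the one at a small y > 0, chosen to solve K C y^(-k alpha) =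
   Y; as Y > - ln e, the limit at y is below e. *)
pose Y := Num.max 1 (1 - ln e).
have Y0 : 0 < Y by rewrite /Y lt_max ltr01.
pose y := (Y / (K * C)) `^ (- (k%:R * alpha)^-1).
have y0 : 0 < y by rewrite powR_gt0// divr_gt0.
have : expR (- (K * C * y `^ (- (k%:R * alpha)))) < e.
  rewrite /y -powRrM mulrNN mulVf ?gt_eqF// powRr1 ?divr_ge0 ?(ltW Y0) ?(ltW KC0)//.
  rewrite mulrC divfK ?gt_eqF// -[ltRHS]lnK ?posrE// ltr_expR.
  have : 1 - ln e <= Y by rewrite /Y le_max lexx orbT.
  lra.
rewrite -subr_gt0 => h; near=> n.
have cn : 0 < c n by near: n.
have T0 z : 0 <= T z by apply: nbG_ge0 => //; exact: df_le1.
rewrite sub0r normrN ger0_norm ?exprn_ge0//.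
have : `|expR (- (K * C * y `^ (- (k%:R * alpha)))) - T (c n * y + 0) ^+ n|
     < e - expR (- (K * C * y `^ (- (k%:R * alpha)))).
  by near: n; move/cvgrPdist_lt : (pos y y0); exact.
rewrite ltr_norml => /andP[h1 _].
have : T (c n * x + 0) ^+ n <= T (c n * y + 0) ^+ n.
  apply: lerXn2r; rewrite ?nnegrE//; have [homoT _ _ _] := dT; apply: homoT.
  by rewrite lerD2r ler_pM2l// (le_trans x0)// ltW.
lra.
Unshelve. all: by end_near. Qed.

Lemma Tk_weibull : (forall x, 0 < -1 * x ->
     n%:R * (1 - F (a n * x + b n)) @[n --> \oo] --> rho (-1) alpha x) ->
  (forall x, 0 < x -> n%:R * (1 - F (a n * x + b n)) @[n --> \oo] --> (0 : R)) ->
  exists e, [/\ right_extremity F = e%:E, (\forall n \near \oo, 0 < e - c n) &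
  forall x, T ((e - c n) * x + e) ^+ n @[n --> \oo] --> Psi (k%:R * alpha) x `^ (K * C)].
Proof.
move=> F_attr F_attr0.
have [e [re Fe lte eb]] := weibull_right_end alpha0 dF cF a_gt0 F_attr F_attr0.
have c_lt : \forall n \near \oo, 0 < e - c n.
  by apply: filterS power_norming_lt1 => n; rewrite lte subr_gt0.
exists e; split => // x.
rewrite /Psi; case: ifPn => [x0|].
  have h : 0 < -1 * x by rewrite mulN1r oppr_gt0.
  rewrite -expRM mulNr mulrC (_ : _ `^ (k%:R * alpha) = rho (-1) alpha x ^+ k); last first.
    rewrite /rho mulN1r opprK -powR_mulrn ?powR_ge0// -powRrM; congr (_ `^ _); ring.
  apply: Tk_power_norming.
  apply: cvg_trans (attraction_ratio (or_intror (erefl (-1))) alpha0 F_homo a_gt0 F_attr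
    eb power_norming_lt1 power_norming_cvg1 h).
  by apply: near_eq_cvg; apply: nearW => n; rewrite mulN1r opprB.
rewrite -leNgt => x0; rewrite powR1.
have : (1 : R) @[n --> \oo] --> (1 : R) by exact: cvg_cst.
apply: cvg_trans; apply: near_eq_cvg; apply: filterS c_lt => n cn.
(* For x >= 0 the argument is at or beyond the right end e. *)
rewrite (_ : T _ = 1) ?expr1n//; apply/eqP; rewrite eq_le df_le1//=.
by rewrite leNgt T_lt1 lte -leNgt lerDr mulr_ge0// ltW.
Qed.

End power_norming.

Section gumbel.
Variables (a b : nat -> R) (v : R -> R).
Hypotheses (a_gt0 : forall n, 0 < a n)
  (F_attr : forall x, n%:R * (1 - F (a n * x + b n)) @[n --> \oo] --> expR (- x))
  (v_lim : (fun t => (1 - F (t + v t * 1)) / (1 - F t))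
            @ left_filter (right_extremity F) --> expR (- 1)).

Let ratio (c : nat -> R) (x : R) :
  (\forall n \near \oo, F (c n) < 1) -> F (c n) @[n --> \oo] --> (1 : R) ->
  (1 - F (c n + v (c n) * x)) / (1 - F (c n)) @[n --> \oo] --> expR (- x).
Proof.
move=> c1 Fc; apply: (@gumbel_ratio _ _ a b) => //.
have : (1 - F (c n + v (c n) * 1)) / (1 - F (c n)) @[n --> \oo] --> expR (- 1).
  by apply: cvg_comp v_lim; exact: cvg_left_filter.
by apply: cvg_trans; apply: near_eq_cvg; apply: nearW => n /=; rewrite mulr1.
Qed.

Lemma F_gumbel (x : R) : let c n := quantile F (1 - 1 / n%:R) in
  F (v (c n) * x + c n) ^+ n @[n --> \oo] --> Lambda x.
Proof.
move=> c; apply: cvg_pow_expR => [n|]; first exact: df_le1.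
under eq_fun do rewrite [_ * x + _]addrC.
apply: cvg_ratio_inv (quantile_n_tail dF cF).
by apply: ratio; [exact: quantile_n_lt1|exact: quantile_n_cvg1].
Qed.

(** Over a step v x / k the tail of F shrinks by e^(-x/k), hence that of T_k by the kth power
    e^(-x): this is the origin of the division of v by k. Since n (1 - T_k (c_n)) -> 1 by the choice
    of c_n, only the ratio of the two tails of T_k matters. *)
Lemma Tk_gumbel (x : R) : let c n := quantile T (1 - 1 / n%:R) in
  T (v (c n) / k%:R * x + c n) ^+ n @[n --> \oo] --> Lambda x.
Proof.
move=> c; apply: cvg_pow_expR => [n|]; first exact: df_le1.
have c1 : \forall n \near \oo, F (c n) < 1.
  by apply: filterS (quantile_n_lt1 dT cT) => n; rewrite T_lt1.
have Fc : F (c n) @[n --> \oo] --> (1 : R).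
  (* The points c_n are quantiles of T_k; they approach the right end, which T_k shares with F, and
     this carries the limit 1 over to F. *)
  apply: (@cvg_comp _ _ _ c F _ _ _ _ (left_filter_cvg1 dF cF)).
  rewrite -(Tk_right_extremity dF r0 k0).
  by apply: (cvg_left_filter dT cT); [exact: quantile_n_lt1|exact: quantile_n_cvg1].
pose z n := v (c n) / k%:R * x + c n.
pose M n := (1 - F (c n))^-1.
have Mc : M n * (1 - F (c n)) @[n --> \oo] --> (1 : R).
  have : (1 : R) @[n --> \oo] --> (1 : R) by exact: cvg_cst.
  apply: cvg_trans; apply: near_eq_cvg; apply: filterS c1 => n cn.
  by rewrite /M mulVf// gt_eqF// subr_gt0.
have Mz : M n * (1 - F (z n)) @[n --> \oo] --> expR (- (x / k%:R)).
  have : (1 - F (c n + v (c n) * (x / k%:R))) / (1 - F (c n)) @[n --> \oo] --> expR (- (x / k%:R)).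
    exact: ratio.
  apply: cvg_trans; apply: near_eq_cvg; apply: nearW => n.
  by rewrite /M /z mulrC; congr (_ * (1 - F _)); ring.
have Fz : F (z n) @[n --> \oo] --> (1 : R).
  have : 1 - M n * (1 - F (z n)) * (1 - F (c n)) @[n --> \oo] --> 1 - expR (- (x / k%:R)) * (1 - 1).
    by apply: cvgB; [exact: cvg_cst|apply: cvgM => //; apply: cvgB => //; exact: cvg_cst].
  rewrite subrr mulr0 subr0; apply: cvg_trans; apply: near_eq_cvg; apply: filterS c1 => n cn.
  by rewrite /M; field; rewrite gt_eqF// subr_gt0.
have Tz : M n ^+ k * (1 - T (z n)) @[n --> \oo] --> C * expR (- (x / k%:R)) ^+ k.
  exact: Tk_tail_transfer.
have Tc : M n ^+ k * (1 - T (c n)) @[n --> \oo] --> C * 1 ^+ k.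
  exact: Tk_tail_transfer.
apply: (cvg_ratio_inv _ (quantile_n_tail dT cT)).
have : (C^-1 * (M n ^+ k * (1 - T (z n)))) @[n --> \oo] --> C^-1 * (C * expR (- (x / k%:R)) ^+ k).
  by apply: cvgM => //; exact: cvg_cst.
have : (C^-1 * (M n ^+ k * (1 - T (c n)))) @[n --> \oo] --> C^-1 * (C * 1 ^+ k).
  by apply: cvgM => //; exact: cvg_cst.
rewrite expr1n mulr1 mulVf ?gt_eqF// mulKf ?gt_eqF//.
rewrite -expRM_natr mulNr divfK ?pnatr_eq0 -?lt0n// => Tc' Tz'.
apply: (@cvg_ratio _ _ _ _ (fun n => C^-1 * M n ^+ k)).
- by apply: cvg_trans Tz'; apply: near_eq_cvg; apply: nearW => n; rewrite mulrA.
- by apply: cvg_trans Tc'; apply: near_eq_cvg; apply: nearW => n; rewrite mulrA.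
Qed.

End gumbel.

End Tk_attraction.

Theorem theorem4p7 (R : realType) (d : measure_display) (Om : measurableType d)
  (P : probability Om R) (X : {RV P >-> R}) (F f : R -> R)
  (hF : forall x : R, (F x)%:E = cdf X x) (hf : is_pdf F f)
  (r : R) (hr : 0 < r) (k : nat) (hk : (0 < k)%N) :
  let T := Tk r k F in
  (* (a) *)
  [/\ [/\ is_df T, is_pdf T (tk r k F f),
          right_extremity T = right_extremity F,
          (fun x => (1 - T x) / (1 - F x) ^+ k)
            @ left_filter (right_extremity F) --> 1 / (k%:R * Beta r k%:R) &
          tail_equivalent T (Hk k F)],
  (* (b) *)
      (forall alpha : R, 0 < alpha -> Dl F (Phi alpha) ->
        [/\ right_extremity T = right_extremity F,
            right_extremity F = +oo%E,
            Dl T (Phi (k%:R * alpha)),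
            (let a n := quantile F (1 - (1 / n%:R) `^ (1 / k%:R)) in
             forall x : R, T (a n * x + 0) ^+ n @[n --> \oo]
               --> Phi (k%:R * alpha) x `^ (1 / (k%:R * Beta r k%:R))) &
            (let a n := quantile F
               (1 - (k%:R * Beta r k%:R / n%:R) `^ (1 / k%:R)) in
             forall x : R, T (a n * x + 0) ^+ n @[n --> \oo]
               --> Phi (k%:R * alpha) x)]),
  (* (c) *)
      (forall alpha : R, 0 < alpha -> Dl F (Psi alpha) ->
        [/\ right_extremity T = right_extremity F,
            (right_extremity F < +oo)%E,
            Dl T (Psi (k%:R * alpha)),
            (let b := fine (right_extremity F) in
             let a n := b - quantile F (1 - (1 / n%:R) `^ (1 / k%:R)) in
             forall x : R, T (a n * x + b) ^+ n @[n --> \oo]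
               --> Psi (k%:R * alpha) x `^ (1 / (k%:R * Beta r k%:R))) &
            (let b := fine (right_extremity F) in
             let a n := b - quantile F
               (1 - (k%:R * Beta r k%:R / n%:R) `^ (1 / k%:R)) in
             forall x : R, T (a n * x + b) ^+ n @[n --> \oo]
               --> Psi (k%:R * alpha) x)]) &
  (* (d) *)
      (forall v : R -> R,
        Dl F (@Lambda R) ->
        (forall t : R, (t%:E < right_extremity F)%E -> 0 < v t) ->
        (forall x : R, 0 <= x ->
          (fun t => (1 - F (t + v t * x)) / (1 - F t))
            @ left_filter (right_extremity F) --> expR (- x)) ->
        [/\ (let b n := quantile F (1 - 1 / n%:R) in
             let a n := v (b n) in
             forall x : R, F (a n * x + b n) ^+ n @[n --> \oo] --> Lambda x),
            right_extremity T = right_extremity F,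
            Dl T (@Lambda R) &
            (let b n := quantile T (1 - 1 / n%:R) in
             let a n := v (b n) / k%:R in
             forall x : R, T (a n * x + b n) ^+ n @[n --> \oo]
               --> Lambda x)])].
Proof.
have dF := cdf_is_df hF; have pF := hf.
have cF := df_continuous dF hf.
have C0 := nbcoef_gt0 k hr.
have B0 : 0 < k%:R * Beta r k%:R by rewrite mulr_gt0 ?ltr0n// Beta_gt0.
have CE : 1 / (k%:R * Beta r k%:R) = nbcoef r k by rewrite Beta_nbcoef// div1r invrK.
have BC : k%:R * Beta r k%:R * nbcoef r k = 1 by rewrite -CE div1r divff// gt_eqF.
have F0 := df_ge0 hf.
move=> T; have reT : right_extremity T = right_extremity F by exact: Tk_right_extremity.
split.
- split => //.
  + exact: Tk_is_df dF hf hr hk.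
  + exact: Tk_is_pdf.
  + by rewrite CE; exact: (Tk_tail_ratio dF hf hr hk).
  + exact: (Tk_tail_equivalent dF hf hr hk).
- move=> alpha alpha0 [a [b [a_gt0 FG]]].
  have F_attr x : 0 < 1 * x -> n%:R * (1 - F (a n * x + b n)) @[n --> \oo] --> rho 1 alpha x.
    rewrite mul1r => x0; apply: (Dl_exponent dF FG) => //; first exact: Phi_continuous.
    by rewrite /Phi x0 /rho mul1r gtr0_norm.
  have W K (K0 : 0 < K) := Tk_frechet dF hf hr hk K0 alpha0 a_gt0 F_attr.
  have [_ W1] := W 1 ltr01; have [cB WB] := W _ B0.
  have WB' (x : R) : T (quantile F (1 - (k%:R * Beta r k%:R / n%:R) `^ (1 / k%:R)) * x + 0) ^+ n
      @[n --> \oo] --> Phi (k%:R * alpha) x.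
    have := WB x; rewrite BC powRr1//.
    by rewrite /Phi; case: ifP; rewrite ?expR_ge0.
  split.
  + exact: reT.
  + case: (right_extremity_cases dF cF) => [[]//|[x [_ Fx _]]].
    by have := frechet_lt1 alpha0 _ a_gt0 F_attr x; rewrite Fx ltxx => /(_ (df_homo dF)).
  + exact: Dl_eventually cB WB'.
  + by move=> c x; rewrite CE -[nbcoef r k]mul1r; exact: W1.
  + exact: WB'.
- move=> alpha alpha0 [a [b [a_gt0 FG]]].
  have F_attr x : 0 < -1 * x -> n%:R * (1 - F (a n * x + b n)) @[n --> \oo] --> rho (-1) alpha x.
    rewrite mulN1r oppr_gt0 => x0; apply: (Dl_exponent dF FG) => //.
      by apply: Psi_continuous; rewrite lt_eqF.
    by rewrite /Psi x0 /rho mulN1r opprK.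
  have F_attr0 x : 0 < x -> n%:R * (1 - F (a n * x + b n)) @[n --> \oo] --> (0 : R).
    move=> x0; apply: (Dl_exponent dF FG) => //.
      by apply: Psi_continuous; rewrite gt_eqF.
    by rewrite /Psi ltNge (ltW x0)/= oppr0 expR0.
  have W K (K0 : 0 < K) := Tk_weibull dF hf hr hk K0 alpha0 a_gt0 F_attr F_attr0.
  have [e [re _ W1]] := W 1 ltr01; have [e' [re' cB WB]] := W _ B0.
  have ee : e' = e by move: re'; rewrite re => -[].
  subst e'.
  have WB' (x : R) :
    T ((e - quantile F (1 - (k%:R * Beta r k%:R / n%:R) `^ (1 / k%:R))) * x + e) ^+ n
      @[n --> \oo] --> Psi (k%:R * alpha) x.
    have := WB x; rewrite BC powRr1//.
    by rewrite /Psi; case: ifP; rewrite ?expR_ge0.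
  split.
  + exact: reT.
  + by rewrite re ltry.
  + exact: Dl_eventually cB WB'.
  + by rewrite re /= => c x; rewrite CE -[nbcoef r k]mul1r; exact: W1.
  + by rewrite re /=; exact: WB'.
- move=> v [a [b [a_gt0 FG]]] v_gt0 v_lim.
  have F_attr x : n%:R * (1 - F (a n * x + b n)) @[n --> \oo] --> expR (- x).
    by apply: (Dl_exponent dF FG) => //; exact: Lambda_continuous.
  have v1 : (fun t => (1 - F (t + v t * 1)) / (1 - F t)) @ left_filter (right_extremity F)
      --> expR (- 1) by exact: v_lim.
  have W := @Tk_gumbel _ _ _ _ _ dF hf hr hk _ _ _ a_gt0 F_attr v1.
  split.
  + move=> c a1 x; have h := @F_gumbel _ _ _ dF hf _ _ _ a_gt0 F_attr v1 x; exact: h.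
  + exact: reT.
  + apply: (Dl_eventually _ W).
    (* Positivity of v is given only to the left of the right end, where the quantiles of T_k
       eventually lie because T_k < 1 exactly where F < 1. *)
    have := quantile_n_lt1 (Tk_is_df dF hf hr hk) (Tk_continuous (k := k) dF hf hr).
    apply: filterS => n; rewrite (Tk_lt1 dF hr hk) => Fc.
    by rewrite divr_gt0 ?ltr0n// v_gt0//; apply/right_extremity_gtP.
  + exact: W.
Qed.
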